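(* Let $T>0$. Assume that $a,b\in L^\infty(0,1)$ are non-negative and that $q\in L^\infty(0,1)$ is real. Let $u_0\in L^2(0,1)$ be such that $u_0''\in L^2(0,1)$, and let $u_1\in L^2(0,1)$, in such a way that a classical solution to the problem $$\begin{cases}\partial_t^2u(t,x)+\mathcal L_qu(t,x)+a(x)u(t,x)+b(x)u_t(t,x)=0,&(t,x)\in[0,T]\times(0,1),\\ u(0,x)=u_0(x),\quad u_t(0,x)=u_1(x),&x\in(0,1),\\ u(t,0)=u(t,1)=0,&t\in[0,T],\end{cases}$$ with $\mathcal L_qu=-\partial_x^2u+qu$, exists. Then, for any regularising families $(a_\varepsilon)_\varepsilon$, $(b_\varepsilon)_\varepsilon$ and $(q_\varepsilon)_\varepsilon$ for the equation coefficients, satisfying $$\|a_\varepsilon-a\|_{L^\infty}\to0,\quad\|b_\varepsilon-b\|_{L^\infty}\to0\quad\text{and}\quad\|q_\varepsilon-q\|_{L^\infty}\to0\qquad\text{as }\varepsilon\to0,$$ and any regularising families $(u_{0,\varepsilon})_\varepsilon$ and $(u_{1,\varepsilon})_\varepsilon$ for the initial data, the net $(u_\varepsilon)_\varepsilon$ (the very weak solution) converges to the classical solution of the initial/boundary problem in $L^2$ as $\varepsilon\to0$.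
   Context: **Operator.** For real $p\in L^\infty(0,1)$, $\mathcal L_p y=-y''+py$ on $(0,1)$ with $y(0)=y(1)=0$; $\lambda_n$ are its eigenvalues and $\phi_n$ the corresponding eigenfunctions, normalised to form an orthonormal basis of $L^2(0,1)$. $\mathcal L_p^{1/2}$ is defined by $\mathcal L_p^{1/2}\phi_n=\lambda_n^{1/2}\phi_n$ for all $n$, and $W^1_{\mathcal L_p}(0,1)$ is the space of $f$ (in the dual of $\bigcap_m\mathrm{Dom}(\mathcal L_p^m)$) with $\mathcal L_p^{1/2}f\in L^2(0,1)$, normed by $\|\mathcal L_p^{1/2}f\|_{L^2}$. **Classical solution.** A solution $u\in C([0,T];W^1_{\mathcal L_q}(0,1))\cap C^1([0,T];L^2(0,1))$ of the problem. **Regularising families.** The regularising nets of $f$ are $(f_\varepsilon)_{\varepsilon\in(0,1]}=(f*\psi_\varepsilon)_{\varepsilon\in(0,1]}$, where $\psi_\varepsilon(x)=\varepsilon^{-1}\psi(x/\varepsilon)$ with $\psi\in C_0^\infty(\mathbb R)$, $\psi\ge0$, $\int\psi=1$. **The net $(u_\varepsilon)$.** It is the very weak solution associated with the chosen families, i.e. for every $\varepsilon\in(0,1]$, $u_\varepsilon$ solves $$\partial_t^2u_\varepsilon+\mathcal L_{q_\varepsilon}u_\varepsilon+a_\varepsilon u_\varepsilon+b_\varepsilon\partial_tu_\varepsilon=0,\quad u_\varepsilon(0,\cdot)=u_{0,\varepsilon},\ \partial_tu_\varepsilon(0,\cdot)=u_{1,\varepsilon},\quad u_\varepsilon(t,0)=u_\varepsilon(t,1)=0$$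 on $[0,T]\times(0,1)$. In the definition of very weak solution, $(a_\varepsilon),(b_\varepsilon)$ are non-negative and $L^\infty$-moderate, $(q_\varepsilon)$ is $L^\infty$-moderate, $(u_{0,\varepsilon})$ is $H^2$-moderate, $(u_{1,\varepsilon})$ is $L^2$-moderate, meaning that $\|a_\varepsilon\|_{L^\infty}$, $\|b_\varepsilon\|_{L^\infty}$, $\|q_\varepsilon\|_{L^\infty}$, $\|u_{0,\varepsilon}\|_{L^2}+\|u_{0,\varepsilon}''\|_{L^2}$ and $\|u_{1,\varepsilon}\|_{L^2}$ are each bounded by $C\varepsilon^{-N}$ for some $C>0$, $N\in\mathbb N_0$, and likewise $\sup_{t\in[0,T]}\big(\|u_\varepsilon(t,\cdot)\|_{L^2}+\|\mathcal L_{q_\varepsilon}^{1/2}u_\varepsilon(t,\cdot)\|_{L^2}+\|\partial_tu_\varepsilon(t,\cdot)\|_{L^2}\big)\le C\varepsilon^{-N}$. *)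

(* Defs.v *)
From HB Require Import structures.
From mathcomp Require Import all_boot all_order all_algebra.
From mathcomp Require Import all_classical all_reals all_analysis.
From mathcomp Require Import complex.

Set Implicit Arguments.
Unset Strict Implicit.
Unset Printing Implicit Defensive.

Import Order.TTheory GRing.Theory Num.Theory.
Import numFieldNormedType.Exports.

Local Open Scope classical_set_scope.
Local Open Scope ring_scope.
Local Open Scope complex_scope.

(* A function on (0,1) is represented by a total function on R whose values
   outside (0,1) are irrelevant: it only enters through f \_ I01, or through
   an integral or an a.e. statement on I01. *)
Definition I01 {R : realType} : set R := `]0, 1[%classic.

Definition ae01 {R : realType} (P : R -> Prop) : Prop :=
  {ae @lebesgue_measure R, forall x, I01 x -> P x}.

Definition cint {R : realType} (A : set R) (f : R -> R[i]) : R[i] :=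
  (\int[lebesgue_measure]_(x in A) complex.Re (f x))
    +i* (\int[lebesgue_measure]_(x in A) complex.Im (f x)).

Definition Linf01 {R : realType} (f : R -> R) : Prop :=
  f \_ I01 \in Lfun (@lebesgue_measure R) +oo%E.

Definition Linf_norm {R : realType} (f : R -> R) : \bar R :=
  'N[@lebesgue_measure R]_(+oo%E)[EFin \o (f \_ I01)].

Definition L2_01 {R : realType} (f : R -> R[i]) : Prop :=
  (fun x => complex.Re (f x)) \_ I01 \in Lfun (@lebesgue_measure R) 2%:E /\
  (fun x => complex.Im (f x)) \_ I01 \in Lfun (@lebesgue_measure R) 2%:E.

Definition L2_norm {R : realType} (f : R -> R[i]) : \bar R :=
  'N[@lebesgue_measure R]_2%:E[EFin \o ((fun x => Normc.normc (f x)) \_ I01)].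

Definition inner {R : realType} (f g : R -> R[i]) : R[i] :=
  cint I01 (fun x => f x * conjc (g x)).

Definition smooth {R : realType} (f : R -> R) : Prop :=
  forall (n : nat) (x : R), derivable (derive1n n f) x 1.

Definition test_function {R : realType} (f : R -> R) : Prop :=
  smooth f /\
  exists a b : R, [/\ 0 < a, b < 1 & forall x, f x != 0 -> a <= x <= b].

Definition weak_derivative2 {R : realType} (f g : R -> R[i]) : Prop :=
  forall h, test_function h ->
    cint I01 (fun x => f x * (derive1n 2 h x)%:C) = cint I01 (fun x => g x * (h x)%:C).

(* y is in Dom(L_p) and L_p y = z. The two integral equations say that y and
   y' = y1 are absolutely continuous on [0,1], with y'' = y2 in L^2. *)
Definition SL_graph {R : realType} (p : R -> R) (y z : R -> R[i]) : Prop :=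
  exists y1 y2 : R -> R[i],
  [/\ L2_01 y2,
      forall x : R, 0 <= x <= 1 -> y x = y 0 + cint `[0, x]%classic y1,
      forall x : R, 0 <= x <= 1 -> y1 x = y1 0 + cint `[0, x]%classic y2,
      y 0 = 0 /\ y 1 = 0
    & ae01 (fun x => z x = - y2 x + (p x)%:C * y x)].

Definition eigenbasis {R : realType} (p : R -> R)
    (lam : nat -> R) (phi : nat -> R -> R[i]) : Prop :=
  [/\ forall n, SL_graph p (phi n) (fun x => (lam n)%:C * phi n x),
      forall m n, inner (phi m) (phi n) = (m == n)%:R
    & forall f, L2_01 f ->
        L2_norm (fun x => f x - \sum_(k < N) inner f (phi k) * phi k x)
          @[N --> \oo] --> 0%E].

(* f is in W^1_{L_p} and L_p^{1/2} f = g. The square root is the complex one: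
   for a potential of no definite sign finitely many lam n may be negative.
   Since lam n tends to +oo, W^1_{L_p} is contained in L^2(0,1), so f is taken
   to be a function rather than an element of the dual of the smooth domain. *)
Definition sqrt_graph {R : realType} (lam : nat -> R) (phi : nat -> R -> R[i])
    (f g : R -> R[i]) : Prop :=
  [/\ L2_01 f, L2_01 g
    & forall n, inner g (phi n) = sqrtc (lam n)%:C * inner f (phi n)].

Definition continuous_L2 {R : realType} (T : R) (u : R -> R -> R[i]) : Prop :=
  forall t : R, 0 <= t <= T -> L2_01 (u t) /\
    L2_norm (fun x => u s x - u t x) @[s --> within `[0, T] (nbhs t)] --> 0%E.

(* v is the derivative in time of u, as a function from [0,T] to L^2(0,1);
   one-sided at the end points. *)
Definition derivative_L2 {R : realType} (T : R) (u v : R -> R -> R[i]) : Prop :=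
  forall t : R, 0 <= t <= T ->
    L2_norm (fun x => ((s - t)^-1)%:C * (u s x - u t x) - v t x)
      @[s --> within `[0, T] t^'] --> 0%E.

Definition has_derivative_in {R : realType} (T : R) (c : R -> R[i]) (t : R)
    (l : R[i]) : Prop :=
  Normc.normc (((s - t)^-1)%:C * (c s - c t) - l)
    @[s --> within `[0, T] t^'] --> (0 : R).

(* The equation, read in the dual of the intersection of the Dom(L_q^m): a test
   function is g 0 for a sequence g of iterates g m = L_q^m (g 0). *)
Definition wave_equation {R : realType} (T : R) (a b q : R -> R)
    (u ut : R -> R -> R[i]) : Prop :=
  forall g : nat -> R -> R[i], (forall m, SL_graph q (g m) (g m.+1)) ->
  forall t : R, 0 <= t <= T ->
    has_derivative_in T (fun s => inner (ut s) (g 0%N)) t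
      (- (inner (u t) (g 1%N)
          + inner (fun x => (a x)%:C * u t x) (g 0%N)
          + inner (fun x => (b x)%:C * ut t x) (g 0%N))).

Definition dirichlet {R : realType} (f : R -> R[i]) : Prop :=
  exists g : R -> R[i],
  [/\ ae01 (fun x => f x = g x),
      {within `[0, 1], continuous (fun x => complex.Re (g x))},
      {within `[0, 1], continuous (fun x => complex.Im (g x))},
      g 0 = 0 & g 1 = 0].

(* u is the solution, ut its time derivative, ru = L_q^{1/2} u. *)
Record wave_solution {R : realType} (lam : nat -> R) (phi : nat -> R -> R[i])
    (T : R) (a b q : R -> R) (u0 u1 : R -> R[i])
    (u ut ru : R -> R -> R[i]) : Prop := WaveSolution {
  wave_sqrt : forall t : R, 0 <= t <= T -> sqrt_graph lam phi (u t) (ru t);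
  wave_cont_W1 : continuous_L2 T ru;
  wave_cont_L2 : continuous_L2 T u;
  wave_deriv : derivative_L2 T u ut;
  wave_cont_deriv : continuous_L2 T ut;
  wave_eq : wave_equation T a b q u ut;
  wave_boundary : forall t : R, 0 <= t <= T -> dirichlet (u t);
  wave_init0 : ae01 (fun x => u 0 x = u0 x);
  wave_init1 : ae01 (fun x => ut 0 x = u1 x) }.

Definition classical_solution {R : realType} (T : R) (a b q : R -> R)
    (u0 u1 : R -> R[i]) (u : R -> R -> R[i]) : Prop :=
  exists (lam : nat -> R) (phi : nat -> R -> R[i]) (ut ru : R -> R -> R[i]),
    eigenbasis q lam phi /\ wave_solution lam phi T a b q u0 u1 u ut ru.

(* Nets (f_eps) are functions of eps : R; only 0 < eps <= 1 is meaningful. *)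

Definition mollifier {R : realType} (psi : R -> R) : Prop :=
  [/\ smooth psi,
      exists M : R, forall x : R, M < `|x| -> psi x = 0,
      forall x : R, 0 <= psi x
    & \int[lebesgue_measure]_x psi x = 1].

Definition dilation {R : realType} (psi : R -> R) (eps x : R) : R :=
  eps^-1 * psi (x / eps).

(* The convolution f * psi_eps on (0,1) needs f beyond (0,1): F is any
   extension of f to R, for instance the one by zero. *)
Definition regularising_coef {R : realType} (f : R -> R) (fe : R -> R -> R)
    : Prop :=
  exists psi F : R -> R,
  [/\ mollifier psi,
      F \in Lfun (@lebesgue_measure R) +oo%E,
      ae01 (fun x => F x = f x)
    & forall eps : R, 0 < eps <= 1 -> forall x,
        fe eps x = \int[lebesgue_measure]_y (F y * dilation psi eps (x - y))].

Definition regularising_data {R : realType} (f : R -> R[i])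
    (fe : R -> R -> R[i]) : Prop :=
  exists (psi : R -> R) (F : R -> R[i]),
  [/\ mollifier psi,
      (fun x => complex.Re (F x)) \in Lfun (@lebesgue_measure R) 2%:E /\
      (fun x => complex.Im (F x)) \in Lfun (@lebesgue_measure R) 2%:E,
      ae01 (fun x => F x = f x)
    & forall eps : R, 0 < eps <= 1 -> forall x,
        fe eps x = cint setT (fun y => F y * (dilation psi eps (x - y))%:C)].

Definition moderate {R : realType} (n : R -> \bar R) : Prop :=
  exists2 C : R, 0 < C &
  exists N : nat, forall eps : R, 0 < eps <= 1 -> (n eps <= (C * eps ^- N)%:E)%E.

Definition H2_moderate {R : realType} (fe : R -> R -> R[i]) : Prop :=
  exists ge : R -> R -> R[i],
  [/\ forall eps : R, 0 < eps <= 1 -> L2_01 (ge eps),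
      forall eps : R, 0 < eps <= 1 -> weak_derivative2 (fe eps) (ge eps)
    & moderate (fun eps => L2_norm (fe eps) + L2_norm (ge eps))%E].

Definition very_weak_solution {R : realType} (T : R) (ae be qe : R -> R -> R)
    (u0e u1e : R -> R -> R[i]) (ue : R -> R -> R -> R[i]) : Prop :=
  [/\ forall eps : R, 0 < eps <= 1 ->
        ae01 (fun x => 0 <= ae eps x) /\ ae01 (fun x => 0 <= be eps x),
      [/\ moderate (fun eps => Linf_norm (ae eps)),
          moderate (fun eps => Linf_norm (be eps))
        & moderate (fun eps => Linf_norm (qe eps))],
      H2_moderate u0e,
      moderate (fun eps => L2_norm (u1e eps))
    & exists (lam : R -> nat -> R) (phi : R -> nat -> R -> R[i])
             (ute rue : R -> R -> R -> R[i]),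
      [/\ forall eps : R, 0 < eps <= 1 -> eigenbasis (qe eps) (lam eps) (phi eps),
          forall eps : R, 0 < eps <= 1 ->
            wave_solution (lam eps) (phi eps) T (ae eps) (be eps) (qe eps)
              (u0e eps) (u1e eps) (ue eps) (ute eps) (rue eps)
        & moderate (fun eps => ereal_sup
            [set (L2_norm (ue eps t) + L2_norm (rue eps t)
                  + L2_norm (ute eps t))%E | t in `[0, T]])]].

(* Main.v *)
Require Import Defs.
From HB Require Import structures.
From mathcomp Require Import all_boot all_order all_algebra.
From mathcomp Require Import all_classical all_reals all_analysis.
From mathcomp Require Import complex.
From mathcomp Require Import measurable_realfun ess_sup_inf ring lra.

Set Implicit Arguments.
Unset Strict Implicit.
Unset Printing Implicit Defensive.

Import Order.TTheory GRing.Theory Num.Theory.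
Import numFieldNormedType.Exports.

Local Open Scope classical_set_scope.
Local Open Scope ring_scope.
Local Open Scope complex_scope.

(** Put [w = ue - u], where [ue] is the solution for the regularised data. The
    initial data of [w] are small in L^2 only, so the usual energy, which
    contains the derivative of [w] in [x], is not small at time 0. The estimate
    is therefore made one level lower.

    Let [lam k], [phi k] be the eigenvalues and eigenfunctions of the limit
    operator [L_q], let [e j] be the real orthonormal basis formed by the
    [phi k] and the ['i * phi k], and write [lam j] for the eigenvalue of
    [e j]. With the real inner product of L^2, put

      [c j = (w, e j)],   [d j = (w_t + be * w, e j)].

    Since [be] does not depend on time, the term [be * w] in [d j] absorbs the
    damping, and the two equations give

      [c j' = d j - (be * w, e j)],   [d j' = - lam j * c j - (G, e j)],
      [G = (qe - q + ae) * w + (qe - q + ae - a) * u + (be - b) * u_t].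

    Green's formula bounds the [lam j] below, so that [nu j = lam j + M >= 1]
    for a suitable [M] depending on a bound of [q] only. In the derivative of

      [E_N = \sum_(j < N) (c j ^ 2 + d j ^ 2 / nu j)]

    the products [c j * d j] cancel up to [M * c j * d j / nu j], whence
    [E_N' <= E_N + C * (|w|^2 + small)] with [C] independent of [N] and of the
    parameter. Letting [N] tend to infinity (Parseval) turns the integrated
    inequality into one for [|w|^2], and Gronwall's argument gives
    [sup |w|^2 = O(small)]; this is [wave_comparison].

    Two points need care. The function [e j] is in the domain of the
    regularised operator, but need not be in the domain of its powers, on which
    alone the equation of [ue] is tested; [wave_domain] extends that equation to
    the domain of the operator, by expanding in its eigenfunctions and passing
    to the limit under the derivative ([derive_approx]). And the mollified
    initial data converge in L^2 ([mollify_cvg_L2]): they converge at every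
    Lebesgue point, mollification is a contraction of L^2, and Fatou's lemma
    applied to [(F_eps + F)^2] together with the parallelogram identity forces
    the L^2 norm of [F_eps - F] to 0. *)

(** * Square-integrable functions on the unit interval *)

Section L2.
Variable R : realType.
Implicit Types (f g h : R -> R[i]) (k : R) (p r : R -> R).
Local Notation mu := (@lebesgue_measure R).

Lemma measurable_I01 : measurable (@I01 R : set (measurableTypeR R)).
Proof. exact: measurable_itv. Qed.
Local Hint Resolve measurable_I01 : core.

Lemma ae01S (P Q : R -> Prop) :
  (forall x, I01 x -> P x -> Q x) -> ae01 P -> ae01 Q.
Proof. by rewrite /ae01 => PQ; apply: (@filterS _ _ (ae_filter_ringOfSetsType mu)) => x H Ix;
  apply: PQ => //; apply: H. Qed.

Lemma ae01I (P Q : R -> Prop) : ae01 P -> ae01 Q -> ae01 (fun x => P x /\ Q x).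
Proof. by rewrite /ae01 => p q; apply: (@filterS2 _ _ (ae_filter_ringOfSetsType mu)) p q =>
  x H K Ix; split; [exact: H|exact: K]. Qed.

Local Notation mfun01 := (measurable_fun (I01 : set (measurableTypeR R))).

(** Real square-integrable functions on (0,1). *)
Definition L2r p := p \_ I01 \in Lfun mu 2%:E.

Lemma Lnorm2E p :
  ('N[mu]_2%:E[EFin \o (p \_ I01)] = ((\int[mu]_(x in I01) (p x ^+ 2)%:E) `^ 2^-1))%E.
Proof.
rewrite unlock; congr (_ `^ _)%E; rewrite [RHS]integral_mkcond.
apply: eq_integral => x _; rewrite /= !patchE; case: ifP => _ //=.
  by rewrite powR_mulrn ?real_normK ?num_real.
by rewrite normr0 powR0.
Qed.

Lemma L2rP p : L2r p <->
  mfun01 p /\ (\int[mu]_(x in I01) (p x ^+ 2)%:E < +oo)%E.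
Proof.
have E : measurable_fun setT (p \_ I01) <-> mfun01 p.
  by split => H; exact/(measurable_restrictT _ measurable_I01).
rewrite /L2r inE; split.
- move=> /andP[]; rewrite !inE/= => /E mp; rewrite /finite_norm Lnorm2E => fp.
  split=> //; apply: (@lty_poweRy _ _ 2^-1) => //.
- case=> /E mp fp; apply/andP; rewrite !inE/=; split => //.
  by rewrite /finite_norm Lnorm2E poweR_lty.
Qed.

Lemma L2r_measurable p : L2r p -> mfun01 p.
Proof. by case/L2rP. Qed.

Lemma integrable_mul p r : L2r p -> L2r r ->
  mu.-integrable I01 (EFin \o (fun x => p x * r x)).
Proof.
move=> lp lr; have := Lfun2_mul_Lfun1 lp lr.
move=> /Lfun1_integrable H; rewrite integrable_mkcond //.
apply: eq_integrable H => // x _ /=. rewrite !patchE. case: ifP => //= _. by rewrite mulr0.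
Qed.

Lemma integrable_L2_sqr p : L2r p -> mu.-integrable I01 (EFin \o (fun x => p x ^+ 2)).
Proof. by move=> lp; apply: eq_integrable (integrable_mul lp lp) => // x _ /=;
  rewrite expr2. Qed.

Lemma L2r_intE p : mfun01 p -> 
  mu.-integrable I01 (EFin \o (fun x => p x ^+ 2)) -> L2r p.
Proof.
move=> mp /integrableP[_ ip]; apply/L2rP; split => //; apply: le_lt_trans ip.
rewrite le_eqVlt; apply/orP; left; apply/eqP; apply: eq_integral => x _ /=.
by rewrite ger0_norm ?sqr_ge0.
Qed.

Lemma L2rD p r : L2r p -> L2r r -> L2r (fun x => p x + r x).
Proof.
move=> lp lr; have mp := L2r_measurable lp; have mr := L2r_measurable lr.
apply: L2r_intE; first exact: measurable_funD.
have := integrableD measurable_I01 (integrableD measurable_I01 (integrable_L2_sqr lp)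
  (integrable_L2_sqr lr))
  (integrableZl measurable_I01 2 (integrable_mul lp lr)).
apply: eq_integrable => // x _ /=; rewrite -EFinM -!EFinD; congr EFin; ring.
Qed.

Lemma L2rZ k p : L2r p -> L2r (fun x => k * p x).
Proof.
move=> lp; have mp := L2r_measurable lp.
apply: L2r_intE; first exact: measurable_funM.
have := (integrableZl measurable_I01 (k ^+ 2) (integrable_L2_sqr lp)).
apply: eq_integrable => // x _ /=; rewrite -EFinM; congr EFin; ring.
Qed.

Lemma L2rN p : L2r p -> L2r (fun x => - p x).
Proof.
by move=> /(L2rZ (-1)); under eq_fun do rewrite mulN1r.
Qed.

Lemma L2rM p r (K : R) : mfun01 p -> ae01 (fun x => `|p x| <= K) ->
  L2r r -> L2r (fun x => p x * r x).
Proof.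
move=> mp pK lr; have mr := L2r_measurable lr.
apply/L2rP; split; first exact: measurable_funM.
have /integrableP[_] := (integrableZl measurable_I01 (K ^+ 2) (integrable_L2_sqr lr)).
apply: le_lt_trans; apply: ae_ge0_le_integral => //.
- by move=> x _; rewrite lee_fin sqr_ge0.
- apply/measurable_EFinP; apply: measurable_funX; exact: measurable_funM.
- apply: measurableT_comp => //.
  apply/measurable_EFinP. apply: measurable_funM => //. exact: measurable_funX.
apply: ae01S pK => x Ix pK; rewrite /= lee_fin.
have K0 : 0 <= K := le_trans (normr_ge0 _) pK.
rewrite exprMn [leRHS]ger0_norm; last exact: mulr_ge0 (sqr_ge0 _) (sqr_ge0 _).
apply: ler_wpM2r; first exact: sqr_ge0.
by rewrite -[leLHS]real_normK ?num_real // ler_sqr ?nnegrE.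
Qed.

Lemma eqL2r p r : p =1 r -> L2r p -> L2r r.
Proof. by move=> /funext ->. Qed.

Lemma L2_D f g : L2_01 f -> L2_01 g -> L2_01 (fun x => f x + g x).
Proof.
move=> [f1 f2] [g1 g2]; split; [have H := L2rD f1 g1|have H := L2rD f2 g2];
  apply: (eqL2r _ H) => x; by case: (f x) (g x) => ? ? [? ?].
Qed.

Lemma L2_N f : L2_01 f -> L2_01 (fun x => - f x).
Proof.
move=> [f1 f2]; split; [have H := L2rN f1|have H := L2rN f2];
  apply: (eqL2r _ H) => x; by case: (f x) => ? ?.
Qed.

Lemma L2_B f g : L2_01 f -> L2_01 g -> L2_01 (fun x => f x - g x).
Proof. by move=> lf lg; apply: L2_D => //; apply: L2_N. Qed.

Lemma L2_M p f (K : R) : mfun01 p -> ae01 (fun x => `|p x| <= K) ->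
  L2_01 f -> L2_01 (fun x => (p x)%:C * f x).
Proof.
move=> mp pK [f1 f2]; split; [have H := L2rM mp pK f1|have H := L2rM mp pK f2];
  apply: (eqL2r _ H) => x; case: (f x) => u v /=; ring.
Qed.

Lemma L2_Z k f : L2_01 f -> L2_01 (fun x => k%:C * f x).
Proof.
by apply: (@L2_M (cst k) f `|k|) => //; apply: aeW => x.
Qed.

Lemma L2_i f : L2_01 f -> L2_01 (fun x => 'i * f x).
Proof.
move=> [f1 f2]; split; [have H := L2rN f2|have H := f1];
  apply: (eqL2r _ H) => x; case: (f x) => u v /=; ring.
Qed.

Lemma L2_cZ (c : R[i]) f : L2_01 f -> L2_01 (fun x => c * f x).
Proof.
move=> lf; have := L2_D (L2_Z (complex.Re c) lf) (L2_Z (complex.Im c) (L2_i lf)).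
congr L2_01; apply/funext => x; case: c (f x) => u v [s t]; congr Complex => /=; ring.
Qed.

Lemma L2_0 : L2_01 (fun _ => 0 : R[i]).
Proof.
have L0 : L2r (fun=> 0).
  apply/L2rP; split; first exact: measurable_cst.
  by under eq_integral do rewrite expr0n/=; rewrite integral0.
by split.
Qed.

Lemma L2_sum (I : Type) (s : seq I) (F : I -> R -> R[i]) :
  (forall i, L2_01 (F i)) -> L2_01 (fun x => \sum_(i <- s) F i x).
Proof.
move=> LF; elim: s => [|i s IH].
  by under eq_fun do rewrite big_nil; exact: L2_0.
by under eq_fun do rewrite big_cons; apply: L2_D.
Qed.

(** * The real inner product, Bessel and Parseval *)

(** The real part of [z * conjc w], that is the scalar product of the plane. *)
Definition rp (z w : R[i]) : R :=
  complex.Re z * complex.Re w + complex.Im z * complex.Im w.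

(** The real part of [inner f g]. By [innerE] the complex inner product is
    recovered from it, and working over the reals makes differentiation in time
    a matter of real-valued functions. *)
Definition rip f g : R := \int[mu]_(x in I01) rp (f x) (g x).

Lemma rip_int f g : L2_01 f -> L2_01 g ->
  mu.-integrable I01 (EFin \o (fun x => rp (f x) (g x))).
Proof.
move=> [f1 f2] [g1 g2].
have := integrableD measurable_I01 (integrable_mul f1 g1) (integrable_mul f2 g2).
by apply: eq_integrable.
Qed.

Lemma eq_rip f f' g g' : (forall x, I01 x -> f x = f' x) -> (forall x, I01 x -> g x = g' x) ->
  rip f g = rip f' g'.
Proof. by move=> ff gg; apply: eq_Rintegral => x /[1!inE] Ix; rewrite ff ?gg. Qed.

Lemma rip_ae f f' g : L2_01 f -> L2_01 f' -> L2_01 g ->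
  ae01 (fun x => f x = f' x) -> rip f g = rip f' g.
Proof.
move=> lf lf' lg ff; rewrite /rip /Rintegral; congr fine; apply: ae_eq_integral => //.
- by have /integrableP[] := rip_int lf lg.
- by have /integrableP[] := rip_int lf' lg.
by apply: ae01S ff => x _ /= ->.
Qed.

Lemma ripC f g : rip f g = rip g f.
Proof. by apply: eq_Rintegral => x _; rewrite /rp; ring. Qed.

Lemma ripDl f g h : L2_01 f -> L2_01 g -> L2_01 h ->
  rip (fun x => f x + g x) h = rip f h + rip g h.
Proof.
move=> lf lg lh; rewrite /rip -RintegralD //; [|exact: rip_int|exact: rip_int].
by apply: eq_Rintegral => x _; rewrite /rp; case: (f x) (g x) => ? ? [? ?] /=; ring.
Qed.

Lemma ripZl k f h : L2_01 f -> L2_01 h -> rip (fun x => k%:C * f x) h = k * rip f h.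
Proof.
move=> lf lh; rewrite /rip -RintegralZl //; last exact: rip_int.
by apply: eq_Rintegral => x _; rewrite /rp; case: (f x) => ? ? /=; ring.
Qed.

Lemma ripNl f h : L2_01 f -> L2_01 h -> rip (fun x => - f x) h = - rip f h.
Proof.
move=> lf lh; rewrite -mulN1r -ripZl //; apply: eq_rip => // x _.
by case: (f x) => u v; congr Complex => /=; ring.
Qed.

Lemma ripBl f g h : L2_01 f -> L2_01 g -> L2_01 h ->
  rip (fun x => f x - g x) h = rip f h - rip g h.
Proof. by move=> lf lg lh; rewrite ripDl ?ripNl //; exact: L2_N. Qed.

Lemma ripDr f g h : L2_01 f -> L2_01 g -> L2_01 h ->
  rip h (fun x => f x + g x) = rip h f + rip h g.
Proof. by move=> *; rewrite ripC ripDl // !(ripC h). Qed.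

Lemma ripBr f g h : L2_01 f -> L2_01 g -> L2_01 h ->
  rip h (fun x => f x - g x) = rip h f - rip h g.
Proof. by move=> *; rewrite ripC ripBl // !(ripC h). Qed.

Lemma ripZr k f h : L2_01 f -> L2_01 h -> rip h (fun x => k%:C * f x) = k * rip h f.
Proof. by move=> *; rewrite ripC ripZl // (ripC h). Qed.

Lemma ripii f g : rip (fun x => 'i * f x) (fun x => 'i * g x) = rip f g.
Proof. by apply: eq_Rintegral => x _; rewrite /rp; case: (f x) (g x) => ? ? [? ?] /=; ring. Qed.

Lemma ripil f g : L2_01 f -> L2_01 g ->
  rip (fun x => 'i * f x) g = - rip f (fun x => 'i * g x).
Proof.
move=> lf lg; rewrite -mulN1r -ripZr //; last exact: L2_i.
apply: eq_Rintegral => x _; rewrite /rp; case: (f x) (g x) => ? ? [? ?] /=; ring.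
Qed.

Lemma rip0l h : rip (fun=> 0) h = 0.
Proof.
rewrite /rip /Rintegral; under eq_integral do rewrite /rp /= !mul0r addr0.
by rewrite integral0.
Qed.

Lemma rip_suml (I : Type) (s : seq I) (F : I -> R -> R[i]) h :
  (forall i, L2_01 (F i)) -> L2_01 h ->
  rip (fun x => \sum_(i <- s) F i x) h = \sum_(i <- s) rip (F i) h.
Proof.
move=> LF lh; elim: s => [|i s IH].
  by under eq_fun do rewrite big_nil; rewrite rip0l big_nil.
under eq_fun do rewrite big_cons; rewrite ripDl ?IH ?big_cons //; exact: L2_sum.
Qed.

Lemma innerE f g : inner f g = (rip f g) +i* (rip f (fun x => 'i * g x)).
Proof.
rewrite /inner /cint; congr Complex; apply: eq_Rintegral => x _; rewrite /rp;
case: (f x) (g x) => ? ? [? ?] /=; ring.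
Qed.

(** The square of the L^2 norm, as a real number. *)
Definition nrm2 f := rip f f.

Lemma nrm2_ge0 f : 0 <= nrm2 f.
Proof. by apply: Rintegral_ge0 => x _; rewrite /rp -!expr2 addr_ge0 ?sqr_ge0. Qed.

Lemma L2_normE f : L2_01 f -> L2_norm f = (Num.sqrt (nrm2 f))%:E.
Proof.
move=> lf; rewrite /L2_norm Lnorm2E.
have E : (\int[mu]_(x in I01) (Normc.normc (f x) ^+ 2)%:E = (nrm2 f)%:E)%E.
  rewrite /nrm2 /rip /Rintegral fineK; last first.
    by apply: integrable_fin_num => //; have := rip_int lf lf.
  apply: eq_integral => x _; congr EFin; rewrite /rp -!expr2.
  by case: (f x) => u v /=; rewrite sqr_sqrtr // addr_ge0 ?sqr_ge0.
by rewrite E poweR_EFin powR12_sqrt ?nrm2_ge0.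
Qed.

Lemma rip_cauchy_schwarz f g : L2_01 f -> L2_01 g -> rip f g ^+ 2 <= nrm2 f * nrm2 g.
Proof.
move=> lf lg; set a := nrm2 f; set b := rip f g; set c := nrm2 g.
have H t : 0 <= a + 2 * t * b + t ^+ 2 * c.
  have := nrm2_ge0 (fun x => f x + t%:C * g x).
  have lt := L2_Z t lg.
  rewrite /nrm2 ripDl // ?ripDr // ?ripZl ?ripZr //; last exact: L2_D.
  by rewrite (ripC g f) -/b -/(nrm2 f) -/(nrm2 g) -/a -/c => /le_trans; apply;
    rewrite le_eqVlt; apply/orP; left; apply/eqP; ring.
have c0 : 0 <= c := nrm2_ge0 g; have a0 : 0 <= a := nrm2_ge0 f.
have [cE|cn] := eqVneq c 0.
  have [->|bn] := eqVneq b 0; first by rewrite cE expr0n /= mulr0.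
  have := H (- (a + 1) / (2 * b)).
  rewrite cE mulr0 addr0 (_ : 2 * _ * b = - (a + 1)); last by field.
  by lra.
have cp : 0 < c by rewrite lt_neqAle eq_sym cn.
have := H (- b / c); rewrite (_ : _ + _ = (a * c - b ^+ 2) / c); last by field.
by rewrite pmulr_lge0 ?invr_gt0 // subr_ge0.
Qed.

(** The L^2 norm, as a real number; it agrees with [L2_norm] on L^2. *)
Definition nrm f : R := Num.sqrt (nrm2 f).

Lemma nrm_ge0 f : 0 <= nrm f. Proof. exact: sqrtr_ge0. Qed.

Lemma sqr_nrm f : nrm f ^+ 2 = nrm2 f.
Proof. by rewrite sqr_sqrtr ?nrm2_ge0. Qed.

Lemma le_nrm f K : 0 <= K -> (nrm f <= K) = (nrm2 f <= K ^+ 2).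
Proof. by move=> K0; rewrite -sqr_nrm ler_sqr // nnegrE nrm_ge0. Qed.

Lemma sqr_nrm_le f K : nrm f <= K -> nrm2 f <= K ^+ 2.
Proof. by move=> h; rewrite -le_nrm // (le_trans (nrm_ge0 f)). Qed.

Lemma rip_le f g : L2_01 f -> L2_01 g -> `|rip f g| <= nrm f * nrm g.
Proof.
move=> lf lg; rewrite -sqrtrM ?nrm2_ge0 // -sqrtr_sqr.
exact: ler_wsqrtr (rip_cauchy_schwarz lf lg).
Qed.

Lemma nrm2D f g : L2_01 f -> L2_01 g ->
  nrm2 (fun x => f x + g x) = nrm2 f + 2 * rip f g + nrm2 g.
Proof.
move=> lf lg; have lfg := L2_D lf lg.
rewrite /nrm2 ripDl // !ripDr // (ripC g f); ring.
Qed.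

Lemma nrm2B f g : L2_01 f -> L2_01 g ->
  nrm2 (fun x => f x - g x) = nrm2 f - 2 * rip f g + nrm2 g.
Proof.
move=> lf lg; have lfg := L2_B lf lg.
rewrite /nrm2 ripBl // !ripBr // (ripC g f); ring.
Qed.

Lemma nrm2D_le f g : L2_01 f -> L2_01 g ->
  nrm2 (fun x => f x + g x) <= 2 * nrm2 f + 2 * nrm2 g.
Proof.
move=> lf lg; have := nrm2_ge0 (fun x => f x - g x).
rewrite nrm2B // nrm2D //; lra.
Qed.

Lemma nrmD f g : L2_01 f -> L2_01 g ->
  nrm (fun x => f x + g x) <= nrm f + nrm g.
Proof.
move=> lf lg; rewrite le_nrm ?addr_ge0 ?nrm_ge0 // nrm2D // sqrrD !sqr_nrm.
have := le_trans (ler_norm _) (rip_le lf lg); rewrite -mulr_natl; lra.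
Qed.

Lemma nrmN f : L2_01 f -> nrm (fun x => - f x) = nrm f.
Proof.
move=> lf; have lN := L2_N lf; rewrite /nrm /nrm2 ripNl // ripC ripNl // opprK //.
Qed.

Lemma nrmB f g : L2_01 f -> L2_01 g ->
  nrm (fun x => f x - g x) <= nrm f + nrm g.
Proof. by move=> lf lg; rewrite -(nrmN lg); apply: nrmD => //; exact: L2_N. Qed.

Lemma nrm_dist f g : L2_01 f -> L2_01 g ->
  `|nrm f - nrm g| <= nrm (fun x => f x - g x).
Proof.
move=> lf lg; rewrite ler_norml lerBrDr addrC; apply/andP; split.
  have -> : nrm g = nrm (fun x => f x - (f x - g x)).
    by congr nrm; apply/funext => x; rewrite opprB addrC subrK.
  by rewrite lerBlDr; apply: nrmB => //; exact: L2_B.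
have -> : nrm f = nrm (fun x => (f x - g x) + g x).
  by congr nrm; apply/funext => x; rewrite subrK.
by rewrite lerBlDr; apply: nrmD => //; exact: L2_B.
Qed.

Lemma nrm2M_le p f (K : R) : 0 <= K -> mfun01 p -> ae01 (fun x => `|p x| <= K) ->
  L2_01 f -> nrm2 (fun x => (p x)%:C * f x) <= K ^+ 2 * nrm2 f.
Proof.
move=> K0 mp pK lf; have lpf := L2_M mp pK lf.
rewrite /nrm2 /rip -RintegralZl //; last exact: rip_int.
rewrite /Rintegral fine_le //.
- by apply: integrable_fin_num => //; have := rip_int lpf lpf.
- by apply: integrable_fin_num => //; have := integrableZl measurable_I01 (K ^+ 2) (rip_int lf
  lf).
apply: ae_ge0_le_integral => //.
- by move=> x _; rewrite lee_fin /rp -!expr2 addr_ge0 ?sqr_ge0.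
- by have /integrableP[] := rip_int lpf lpf.
- by move=> x _; rewrite lee_fin /rp -!expr2; apply: mulr_ge0;
  [exact: sqr_ge0|rewrite addr_ge0 ?sqr_ge0].
- by have /integrableP[] := integrableZl measurable_I01 (K ^+ 2) (rip_int lf lf).
apply: ae01S pK => x Ix pK; rewrite /= lee_fin.
have -> : rp ((p x)%:C * f x) ((p x)%:C * f x) = p x ^+ 2 * rp (f x) (f x).
  by rewrite /rp; case: (f x) => u v /=; ring.
apply: ler_wpM2r; first by rewrite /rp -!expr2 addr_ge0 ?sqr_ge0.
by rewrite -[leLHS]real_normK ?num_real // ler_sqr ?nnegrE.
Qed.

Lemma nrmM_le p f (K : R) : 0 <= K -> mfun01 p -> ae01 (fun x => `|p x| <= K) ->
  L2_01 f -> nrm (fun x => (p x)%:C * f x) <= K * nrm f.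
Proof.
move=> K0 mp pK lf; rewrite le_nrm ?mulr_ge0 ?nrm_ge0 // exprMn sqr_nrm.
exact: nrm2M_le.
Qed.

Lemma rip_mul p f g : rip (fun x => (p x)%:C * f x) g = rip f (fun x => (p x)%:C * g x).
Proof. by apply: eq_Rintegral => x _; rewrite /rp; case: (f x) (g x) => ? ? [? ?] /=; ring. Qed.

Lemma L2_norm_cvg (T : Type) (F : set_system T) {FF : Filter F} (f : T -> R -> R[i]) :
  (\forall s \near F, L2_01 (f s)) -> L2_norm (f s) @[s --> F] --> 0%E ->
  nrm (f s) @[s --> F] --> 0.
Proof.
move=> lf /fine_cvgP[_]; apply: cvg_trans; apply: near_eq_cvg.
by apply: filterS lf => s lf /=; rewrite L2_normE.
Qed.

(** The functions [phi k] and ['i * phi k], at the indices [k.*2] and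
    [k.*2.+1]: an orthonormal basis of L^2 over the reals when [phi] is one over
    the complex numbers. *)
Definition real_basis (phi : nat -> R -> R[i]) (j : nat) : R -> R[i] :=
  if odd j then fun x => 'i * phi j./2 x else phi j./2.

(** Orthonormality in L^2 for the real inner product. *)
Definition orthonormal (e : nat -> R -> R[i]) :=
  (forall j, L2_01 (e j)) /\ (forall i j, rip (e i) (e j) = (i == j)%:R).

Lemma real_basis_orthonormal (phi : nat -> R -> R[i]) : (forall n, L2_01 (phi n)) ->
  (forall m n, inner (phi m) (phi n) = (m == n)%:R) -> orthonormal (real_basis phi).
Proof.
move=> lp ip.
have ri m n : rip (phi m) (phi n) = (m == n)%:R /\ rip (phi m) (fun x => 'i * phi n x) = 0.
  have := ip m n; rewrite innerE; case: eqP => _ [-> ->] //.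
split=> [j|i j]; first by rewrite /real_basis; case: odd => //; exact: L2_i.
have -> : (i == j) = (odd i == odd j) && (i./2 == j./2).
  apply/eqP/andP => [->//|[/eqP oij /eqP hij]].
  by rewrite -(odd_double_half i) -(odd_double_half j) oij hij.
rewrite /real_basis; case: (odd i) (odd j) => -[] //=.
- by rewrite ripii; case: (ri i./2 j./2).
- by rewrite ripil //; case: (ri i./2 j./2) => _ ->; rewrite oppr0.
- by case: (ri i./2 j./2).
- by case: (ri i./2 j./2).
Qed.

Lemma bessel_eq e f N : orthonormal e -> L2_01 f ->
  nrm2 (fun x => f x - \sum_(j < N) (rip f (e j))%:C * e j x) =
  nrm2 f - \sum_(j < N) rip f (e j) ^+ 2.
Proof.
move=> [le oe] lf.
have lS (s : seq 'I_N) : L2_01 (fun x => \sum_(j <- s) (rip f (e j))%:C * e j x).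
  by apply: L2_sum => j; exact: L2_Z.
rewrite nrm2B // /nrm2 (ripC f) !rip_suml //; try by move=> ?; exact: L2_Z.
rewrite -[_ + \sum_(i < N) _]addrA; congr (_ + _).
have -> : \sum_(i < N) rip (fun x => (rip f (e i))%:C * e i x) f =
  \sum_(i < N) rip f (e i) ^+ 2.
  by apply: eq_bigr => i _; rewrite ripZl // ripC expr2 (ripC (e i)).
suff -> : \sum_(i < N) rip (fun x => (rip f (e i))%:C * e i x) (fun x =>
  \sum_(j < N) (rip f (e j))%:C * e j x)
  = \sum_(i < N) rip f (e i) ^+ 2 by ring.
apply: eq_bigr => i _; rewrite ripZl // (ripC (e i)) rip_suml //; last by move=> ?; exact: L2_Z.
rewrite (bigD1 i) //= ripZl // oe eqxx mulr1 big1 ?addr0 ?expr2 // => j ji.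
by rewrite ripZl // oe val_eqE (negbTE ji) mulr0.
Qed.

Lemma bessel e f N : orthonormal e -> L2_01 f ->
  \sum_(j < N) rip f (e j) ^+ 2 <= nrm2 f.
Proof. by move=> oe lf; rewrite -subr_ge0 -bessel_eq // nrm2_ge0. Qed.

Lemma partial_sumE (phi : nat -> R -> R[i]) f N x : 
  \sum_(k < N) inner f (phi k) * phi k x =
  \sum_(j < N.*2) (rip f (real_basis phi j))%:C * real_basis phi j x.
Proof.
elim: N => [|N IH]; first by rewrite !big_ord0.
rewrite doubleS big_ord_recr /= IH !big_ord_recr /= -addrA; congr (_ + _).
rewrite /real_basis /= odd_double /= uphalf_double half_double innerE.
by case: (phi N x) => u v; congr Complex => /=; ring.
Qed.

Lemma partial_sum_cvg p lam phi f : eigenbasis p lam phi -> (forall n, L2_01 (phi n)) ->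
  L2_01 f ->
  nrm (fun x => f x - \sum_(k < N) inner f (phi k) * phi k x) @[N --> \oo] --> 0.
Proof.
move=> [_ _ /(_ f) H] lp lf; apply: L2_norm_cvg (H lf).
by near=> N; apply: L2_B => //; apply: L2_sum => k; exact: L2_cZ.
Unshelve. all: by end_near. Qed.

(** Completeness of the eigenfunctions, in the form in which a bound on the
    finite sums of squares passes to the limit. *)
Lemma parseval_le p lam phi f (B : R) : eigenbasis p lam phi -> (forall n, L2_01 (phi n)) ->
  L2_01 f -> (forall N, \sum_(j < N) rip f (real_basis phi j) ^+ 2 <= B) -> nrm2 f <= B.
Proof.
move=> eb lp lf H; have oe := real_basis_orthonormal lp (let: And3 _ h _ := eb in h).
have C := partial_sum_cvg eb lp lf.
apply/ler_addgt0Pr => d d0.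
have : \forall N \near \oo, nrm (fun x => f x - \sum_(k < N) inner f (phi k) * phi k x) <=
  Num.sqrt d.
  move/cvgr0Pnorm_le : C => /(_ (Num.sqrt d)); rewrite sqrtr_gt0 => /(_ d0).
  by apply: filterS => N; rewrite ger0_norm ?nrm_ge0.
move=> [N _ /(_ N (leqnn N))] /=; rewrite le_nrm ?sqrtr_ge0 // sqr_sqrtr ?(ltW d0) //.
have -> : (fun x => f x - \sum_(k < N) inner f (phi k) * phi k x) =
    (fun x => f x - \sum_(j < N.*2) (rip f (real_basis phi j))%:C * real_basis phi j x).
  by apply/funext => x; rewrite partial_sumE.
rewrite bessel_eq // => K; have := H N.*2; lra.
Qed.

End L2.

(** * Primitives and Green's formula *)

Section SL.
Variable R : realType.
Implicit Types (f g h : R -> R[i]) (p r P Q : R -> R).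
Local Notation mu := (@lebesgue_measure R).
Local Notation mfun01 := (measurable_fun (I01 : set (measurableTypeR R))).
Local Hint Resolve measurable_I01 : core.

Lemma I01P (x : R) : I01 x <-> 0 < x < 1.
Proof. by rewrite /I01 /= in_itv. Qed.

Lemma L2r_cst (c : R) : L2r (fun _ : R => c).
Proof.
apply/L2rP; split; first exact: measurable_cst.
rewrite integral_cst // /I01 /= lebesgue_measure_itv /= lte_fin ltr01.
by rewrite -EFinB -EFinM ltry.
Qed.

Lemma L2r_integrable p : L2r p -> mu.-integrable I01 (EFin \o p).
Proof.
move=> lp; have := integrable_mul lp (L2r_cst 1).
by apply: eq_integrable => // x _ /=; rewrite mulr1.
Qed.

Lemma L2r_integrable_cc p : L2r p -> mu.-integrable `[0, 1] (EFin \o p).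
Proof.
move=> lp; have /integrableP[mp ip] := L2r_integrable lp.
have mp' : measurable_fun (`[0, 1]%classic : set (measurableTypeR R)) (EFin \o p).
  exact: (emeasurable_fun_itv_cc mp).
apply/integrableP; split => //.
rewrite (@integral_itv_bndoo _ 0 1 _ true false) //; exact: measurableT_comp.
Qed.

Lemma within_bounded P : {within `[0, 1], continuous P} ->
  exists2 K : R, 0 <= K & forall x : R, 0 <= x <= 1 -> `|P x| <= K.
Proof.
move=> cP; have [c1 _ h1] := EVT_max ler01 cP; have [c2 _ h2] := EVT_min ler01 cP.
exists (`|P c1| + `|P c2|) => [|x x01]; first by rewrite addr_ge0.
rewrite ler_norml; have := h1 x; have := h2 x; rewrite in_itv /= => /(_ x01) a /(_ x01) b.
have := ler_norm (P c1); have := ler_norm (- P c2); have := normr_ge0 (P c1);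
  have := normr_ge0 (P c2).
rewrite normrN => *; apply/andP; split; lra.
Qed.

Lemma within_L2r P : {within `[0, 1], continuous P} -> mfun01 P /\ L2r P.
Proof.
move=> cP; have [K K0 bK] := within_bounded cP.
have mP : mfun01 P.
  apply: (@measurable_funS _ _ (measurableTypeR R) R `[0, 1]%classic I01 P) => //.
    by move=> x; rewrite /I01 /= !in_itv /= => /andP[/ltW -> /ltW ->].
  exact: subspace_continuous_measurable_fun.
split => //.
apply: (@eqL2r _ (fun x => P x * 1)); first by move=> x; rewrite mulr1.
apply: (L2rM mP (K := K) _ (L2r_cst 1)).
apply: aeW => x /I01P /andP[/ltW x0 /ltW x1]; apply: bK; exact/andP.
Qed.

(** [P] is an indefinite integral of [p] on [0,1]: when [p] is in L^2, [P] is
    absolutely continuous with almost everywhere derivative [p]. *)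
Definition prim P p := forall x : R, 0 <= x <= 1 -> P x = P 0 + \int[mu]_(t in `[0,
  x]%classic) p t.

Lemma prim_continuous P p : L2r p -> prim P p -> {within `[0, 1], continuous P}.
Proof.
move=> lp pP.
have := parameterized_integral_continuous ler01 (L2r_integrable_cc lp).
move=> c1.
have e : {in `[0, 1]%classic, (fun x => P 0 + \int[mu]_(t in `[0, x]%classic) p t) =1 P}.
  by move=> x; rewrite inE /= in_itv /= => x01; rewrite [RHS]pP.
apply: (subspace_eq_continuous e).
move=> x; apply: cvgD; [exact: cvg_cst|exact: c1].
Qed.

Lemma prim_sub P p (s : R) : L2r p -> prim P p -> 0 < s < 1 ->
  \int[mu]_(x in `]s, 1]%classic) p x = P 1 - P s.
Proof.
move=> lp pP s01; have [s0 s1] := andP s01.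
rewrite [P 1]pP ?ler01 ?lexx // [P s]pP ?(ltW s0) ?(ltW s1) //.
rewrite -(@Rintegral_itvB _ p (BLeft 0) (BRight 1) s) ?bnd_simp ?(ltW s0) ?(ltW s1) //.
  by ring.
exact: L2r_integrable_cc.
Qed.

Lemma L2r_integrableT p : L2r p -> mu.-integrable setT (EFin \o (p \_ I01)).
Proof.
move=> /L2r_integrable; rewrite integrable_mkcond //.
by apply: eq_integrable => // x _; rewrite /= !patchE; case: ifP.
Qed.

(** Integrability of [p(x) r(y)] on a region of the plane, for the use of
    Fubini's theorem in [green_real]. *)
Lemma integrable_tensor p r (D : set (R * R)) :
  mu.-integrable setT (EFin \o p) -> mu.-integrable setT (EFin \o r) ->
  measurable (D : set (measurableTypeR R * measurableTypeR R)) ->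
  (mu \x mu)%E.-integrable setT (EFin \o (fun z : R * R => p z.1 * r z.2 * \1_D z)).
Proof.
move=> ip ir mD.
have /measurable_EFinP mp := measurable_int mu ip.
have /measurable_EFinP mr := measurable_int mu ir.
have mk : measurable_fun (setT : set (measurableTypeR R * measurableTypeR R))
    (fun z : R * R => p z.1 * r z.2 * \1_D z).
  apply: measurable_funM; last exact: measurable_indic.
  apply: measurable_funM; [exact: (measurableT_comp mp)|exact: (measurableT_comp mr)].
apply/integrable12ltyP; first exact/measurable_EFinP.
apply: (@le_lt_trans _ _ (\int[mu]_x ((fine (\int[mu]_y `|r y|%:E))%:E * `|p x|%:E))%E).
  apply: ge0_le_integral => //=.
  - by move=> x _; apply: integral_ge0.
  - apply: (@measurable_fun_fubini_tonelli_F _ _ _ _ _ mu (fun z :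
    R * R => `|p z.1 * r z.2 * \1_D z|%:E)) => //.
    by apply/measurable_EFinP; exact: measurableT_comp.
  - apply: measurable_funeM. by apply/measurable_EFinP; exact: measurableT_comp.
  move=> x _; rewrite muleC.
  have fr : (\int[mu]_y `|r y|%:E < +oo)%E by have /integrableP[] := ir.
  rewrite fineK; last by rewrite ge0_fin_numE // integral_ge0.
  rewrite -ge0_integralZl //; last by apply/measurable_EFinP; exact: measurableT_comp.
  apply: ge0_le_integral => //=.
  - apply/measurable_EFinP; apply: measurableT_comp => //.
    exact: (measurableT_comp mk (pair1_measurable (x : measurableTypeR R))).
  - by apply: measurable_funeM; apply/measurable_EFinP; exact: measurableT_comp.
  move=> y _; rewrite -EFinM lee_fin !normrM -[leRHS]mulr1 ler_wpM2l //.
  by rewrite indicE; case: (_ \in _); rewrite ?normr1 ?normr0.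
rewrite ge0_integralZl //; last first.
- by rewrite lee_fin fine_ge0 // integral_ge0.
- by apply/measurable_EFinP; exact: measurableT_comp.
rewrite lte_mul_pinfty // ?lee_fin ?fine_ge0 ?integral_ge0 //.
by have /integrableP[] := ip.
Qed.

Lemma sub_itv01 (b0 b1 : bool) (u v : R) : 0 <= u -> v <= 1 ->
  [set` Interval (BSide b0 u) (BSide b1 v)] `<=` `[0, 1]%classic.
Proof.
  move=> u0 v1 z; rewrite /= !in_itv => /andP[/lteifW a /lteifW b].
  by apply/andP; split; [exact: le_trans u0 a|exact: le_trans b v1].
Qed.

Lemma integral_scal (c : R) p (A : set (measurableTypeR R)) :
  measurable A -> A `<=` `[0, 1]%classic -> L2r p ->
  (\int[mu]_(x in A) (c * p x)%:E = (c * \int[mu]_(x in A) p x)%:E)%E.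
Proof.
  move=> mA sA lp.
  have iA : mu.-integrable A (EFin \o p).
    by apply: (integrableS _ mA sA) (L2r_integrable_cc lp).
  under eq_integral do rewrite EFinM.
  rewrite integralZl // EFinM /Rintegral fineK //.
  exact: integrable_fin_num.
Qed.

(** Integration by parts for indefinite integrals: both sides come from the
    integral of [p(x) r(y)] over the triangle [y <= x], taken in the two orders.
    The boundary values of [Z] disappear because [r] has integral 0. *)
Lemma green_real p r Z Y : L2r p -> L2r r -> prim Z p -> prim Y r -> Y 0 = 0 -> Y 1 = 0 ->
  \int[mu]_(x in I01) (p x * Y x) = - \int[mu]_(x in I01) (Z x * r x).
Proof.
move=> lp lr pZ pY Y0 Y1.
have [mZ lZ] := within_L2r (prim_continuous lp pZ).
have [mY lY] := within_L2r (prim_continuous lr pY).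
pose p' := p \_ I01; pose r' := r \_ I01.
have ip : mu.-integrable setT (EFin \o p').
  exact: L2r_integrableT.
have ir : mu.-integrable setT (EFin \o r').
  exact: L2r_integrableT.
pose D := [set z : R * R | z.2 <= z.1].
have mD : measurable (D : set (measurableTypeR R * measurableTypeR R)).
  have := @measurable_fun_ler _ (measurableTypeR R * measurableTypeR R)%type R setT snd fst
    measurable_snd measurable_fst measurableT [set true] I.
  by rewrite setTI; congr measurable; apply/seteqP; split => z.
have E1 : (\int[mu]_x \int[mu]_y (EFin \o (fun z : R * R => (p' z.1 * r' z.2 * \1_D z)%R)) (x,
  y) =
  (\int[mu]_(x in I01) (p x * Y x))%:E)%E.
  rewrite /Rintegral fineK; last by apply: integrable_fin_num => //; exact: integrable_mul.
  rewrite [RHS]integral_mkcond; apply: eq_integral => x _; rewrite /= patchE.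
  case: ifPn => [|/negbTE xI]; last first.
    by rewrite integral0_eq // => y _; rewrite /p' patchE xI !mul0r.
  rewrite inE => /[dup] Ix /I01P /andP[x0 x1].
  rewrite [Y x]pY ?(ltW x0) ?(ltW x1) // Y0 add0r.
  (* The end point 0, which I01 omits, is null. *)
  rewrite -Rintegral_itv_obnd_cbnd; last first.
    by apply: integrableS (L2r_integrable_cc lr) => //; apply: sub_itv01 => //; exact: ltW.
  rewrite -integral_scal //; last by apply: sub_itv01 => //; exact: ltW.
  rewrite [RHS]integral_mkcond; apply: eq_integral => y _; rewrite patchE.
  rewrite /p' /r' !patchE (mem_set Ix) indicE /D.
  have -> : ((x, y) \in [set z : R * R | z.2 <= z.1]) = (y <= x).
    by apply/idP/idP; rewrite inE.
  have -> : (y \in `]0, x]%classic) = (0 < y <= x).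
    by apply/idP/idP; rewrite inE /= in_itv.
  have -> : (y \in I01) = (0 < y < 1).
    by apply/idP/idP; rewrite inE => /I01P.
  case: (ltP 0 y) => y0 /=; last by rewrite mulr0 mul0r.
  case: (leP y x) => yx /=; last by rewrite mulr0.
  by rewrite (le_lt_trans yx x1) mulr1.
have E2 : (\int[mu]_y \int[mu]_x (EFin \o (fun z : R * R => (p' z.1 * r' z.2 * \1_D z)%R)) (x,
  y) =
  (\int[mu]_(x in I01) (r x * (Z 1 - Z x)))%:E)%E.
  rewrite /Rintegral fineK; last first.
    apply: integrable_fin_num => //; apply: integrable_mul => //.
    by have := L2rD (L2r_cst (Z 1)) (L2rN lZ).
  rewrite [RHS]integral_mkcond; apply: eq_integral => y _; rewrite /= patchE.
  case: ifPn => [|/negbTE yI]; last first.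
    by rewrite integral0_eq // => x _; rewrite /r' patchE yI mulr0 !mul0r.
  rewrite inE => /[dup] Iy /I01P /andP[y0 y1].
  rewrite -(prim_sub lp pZ); last exact/I01P.
  rewrite -integral_scal //; last by apply: sub_itv01 => //; exact: ltW.
  have mp : measurable_fun (`]y, 1[%classic : set (measurableTypeR R)) (fun x =>
    (r y * p x)%:E).
    apply/measurable_EFinP; apply: measurable_funM => //.
    by apply: measurable_funS (L2r_measurable lp) => //; apply: subset_itvr;
      rewrite bnd_simp ltW.
  (* The triangle contains the point y and I01 omits the point 1; both are null. *)
  rewrite integral_itv_bndoo // -(integral_itv_bndoo true true) //.
  rewrite [RHS]integral_mkcond; apply: eq_integral => x _; rewrite patchE.
  rewrite /p' /r' !patchE (mem_set Iy) indicE /D.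
  have -> : ((x, y) \in [set z : R * R | z.2 <= z.1]) = (y <= x).
    by apply/idP/idP; rewrite inE.
  have -> : (x \in `[y, 1[%classic) = (y <= x < 1).
    by apply/idP/idP; rewrite inE /= in_itv.
  have -> : (x \in I01) = (0 < x < 1).
    by apply/idP/idP; rewrite inE => /I01P.
  case: (leP y x) => yx /=; last by rewrite mulr0.
  rewrite (lt_le_trans y0 yx) mulr1.
  by case: (ltP x 1) => x1 /=; rewrite ?mul0r // mulrC.
(* The right-hand side so obtained carries Z 1 - Z x; Z 1 drops out
   because r has integral 0. *)
move: (Fubini (integrable_tensor ip ir mD)); rewrite E1 E2 => -[->].
have i1 : mu.-integrable I01 (EFin \o (fun x => Z 1 * r x)).
  exact: integrableZl (L2r_integrable lr).
have i2 := integrable_mul lZ lr.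
transitivity (\int[mu]_(x in I01) (Z 1 * r x - Z x * r x)).
  by apply: eq_Rintegral => x _; ring.
rewrite RintegralB // RintegralZl //; last exact: L2r_integrable.
suff -> : \int[mu]_(x in I01) r x = 0 by rewrite mulr0 sub0r.
have := pY 1; rewrite Y0 Y1 add0r ler01 lexx => /(_ isT) ->.
rewrite /Rintegral (integral_itv_bndoo true false) //.
by have /integrableP[] := L2r_integrable lr.
Qed.

Lemma primZ P p (c : R) : L2r p -> prim P p -> prim (fun x => c * P x) (fun x => c * p x).
Proof.
move=> lp pP x x01; rewrite [P x]pP // mulrDr; congr (_ + _).
have [_ x1] := andP x01.
rewrite RintegralZl //.
by apply: integrableS (L2r_integrable_cc lp) => //; exact: (@sub_itv01 true false).
Qed.

Lemma eq_prim P Q p r : P =1 Q -> p =1 r -> prim P p -> prim Q r.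
Proof. by move=> /funext -> /funext ->. Qed.

(** * The Sturm-Liouville operator *)

(** [y] vanishes at 0 and 1, [y1] is its derivative and [y2] its second
    derivative, with [y] and [y1] absolutely continuous and [y2] in L^2. That
    [y1] is in L^2 as well follows from the rest; it is kept for convenience. *)
Definition dirichlet2 y y1 y2 : Prop :=
  [/\ L2_01 y1 /\ L2_01 y2,
      prim (fun x => complex.Re (y x)) (fun x => complex.Re (y1 x)) /\
      prim (fun x => complex.Im (y x)) (fun x => complex.Im (y1 x)),
      prim (fun x => complex.Re (y1 x)) (fun x => complex.Re (y2 x)) /\
      prim (fun x => complex.Im (y1 x)) (fun x => complex.Im (y2 x)),
      y 0 = 0 & y 1 = 0].

Lemma prim_complex f g :
  (forall x : R, 0 <= x <= 1 -> f x = f 0 + cint `[0, x]%classic g) <->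
  prim (fun x => complex.Re (f x)) (fun x => complex.Re (g x)) /\
      prim (fun x => complex.Im (f x)) (fun x => complex.Im (g x)).
Proof.
split=> [H|[H1 H2] x x01].
  by split=> x x01; rewrite H // /cint; case: (f 0).
rewrite /cint; have := H1 x x01; have := H2 x x01.
by case: (f x) (f 0) => ? ? [? ?] /= -> ->.
Qed.

Lemma SL_graphP p f g : SL_graph p f g <->
  exists y1 y2, dirichlet2 f y1 y2 /\ ae01 (fun x => g x = - y2 x + (p x)%:C * f x).
Proof.
split=> -[y1 [y2]].
  case=> l2 /prim_complex [h1 h2] /prim_complex [k1 k2] [f0 f1] ag; exists y1, y2; split => //.
  split => //; split => //; split.
    by have [] := within_L2r (prim_continuous (proj1 l2) k1).
  by have [] := within_L2r (prim_continuous (proj2 l2) k2).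
case=> -[[l1 l2] /prim_complex h1 /prim_complex h2 f0 f1] ag.
by exists y1, y2; split.
Qed.

Lemma dirichlet2_L2 y y1 y2 : dirichlet2 y y1 y2 -> L2_01 y.
Proof.
by case=> -[[l1 l2] _] [h1 h2] _ _ _; split;
  [case: (within_L2r (prim_continuous l1 h1))|case: (within_L2r (prim_continuous l2 h2))].
Qed.

Lemma dirichlet2Z y y1 y2 (c : R) : dirichlet2 y y1 y2 ->
  dirichlet2 (fun x => c%:C * y x) (fun x => c%:C * y1 x) (fun x => c%:C * y2 x).
Proof.
have ReM (z : R[i]) : complex.Re (c%:C * z) = c * complex.Re z by case: z => a b /=; ring.
have ImM (z : R[i]) : complex.Im (c%:C * z) = c * complex.Im z by case: z => a b /=; ring.
case=> -[l1 l2] [h1 h2] [k1 k2] y0 y1'; split; rewrite ?y0 ?y1' ?mulr0 //.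
- by split; exact: L2_Z.
- have [l11 l12] := l1; split.
    by apply: (eq_prim _ _ (primZ c l11 h1)) => x; rewrite ReM.
  by apply: (eq_prim _ _ (primZ c l12 h2)) => x; rewrite ImM.
- have [l21 l22] := l2; split.
    by apply: (eq_prim _ _ (primZ c l21 k1)) => x; rewrite ReM.
  by apply: (eq_prim _ _ (primZ c l22 k2)) => x; rewrite ImM.
Qed.

Lemma SL_graphZ p f g (c : R) : SL_graph p f g ->
  SL_graph p (fun x => c%:C * f x) (fun x => c%:C * g x).
Proof.
move=> /SL_graphP[y1 [y2 [d ag]]]; apply/SL_graphP.
exists (fun x => c%:C * y1 x), (fun x => c%:C * y2 x); split; first exact: dirichlet2Z.
by apply: ae01S ag => x _ ->; ring.
Qed.

Lemma SL_graph_L2 p f g : SL_graph p f g -> L2_01 f.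
Proof. by move=> /SL_graphP[y1 [y2 [d ag]]]; exact: dirichlet2_L2 d. Qed.

Lemma dirichlet2_i y y1 y2 : dirichlet2 y y1 y2 ->
  dirichlet2 (fun x => 'i * y x) (fun x => 'i * y1 x) (fun x => 'i * y2 x).
Proof.
have ReM (z : R[i]) : complex.Re ('i * z) = - complex.Im z by case: z => a b /=; ring.
have ImM (z : R[i]) : complex.Im ('i * z) = complex.Re z by case: z => a b /=; ring.
case=> -[l1 l2] [h1 h2] [k1 k2] y0 y1'; split; rewrite ?y0 ?y1' ?mulr0 //.
- by split; exact: L2_i.
- have [l11 l12] := l1; split.
    by apply: (eq_prim _ _ (primZ (-1) l12 h2)) => x; rewrite ReM mulN1r.
  by apply: (eq_prim _ _ h1) => x; rewrite ImM.
- have [l21 l22] := l2; split.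
    by apply: (eq_prim _ _ (primZ (-1) l22 k2)) => x; rewrite ReM mulN1r.
  by apply: (eq_prim _ _ k1) => x; rewrite ImM.
Qed.

Lemma SL_graph_i p f g : SL_graph p f g ->
  SL_graph p (fun x => 'i * f x) (fun x => 'i * g x).
Proof.
move=> /SL_graphP[y1 [y2 [d ag]]]; apply/SL_graphP.
exists (fun x => 'i * y1 x), (fun x => 'i * y2 x); split; first exact: dirichlet2_i.
by apply: ae01S ag => x _ ->; ring.
Qed.

(** Green's formula for two functions of the domain. *)
Lemma green f f1 f2 g g1 g2 : dirichlet2 f f1 f2 -> dirichlet2 g g1 g2 ->
  rip f2 g = - rip f1 g1.
Proof.
move=> df dg; have lf := dirichlet2_L2 df; have lg := dirichlet2_L2 dg.
case: df dg => -[l1 l2] [h1 h2] [k1 k2] _ _ [[m1 m2] [i1 i2] _ g0 gl].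
have split_rip u v : L2_01 u -> L2_01 v -> rip u v =
    \int[mu]_(x in I01) (complex.Re (u x) * complex.Re (v x)) +
    \int[mu]_(x in I01) (complex.Im (u x) * complex.Im (v x)).
  by move=> [u1 u2] [v1 v2]; rewrite /rip /rp RintegralD //; exact: integrable_mul.
rewrite !split_rip // opprD.
have [l21 l22] := l2; have [m11 m12] := m1.
by rewrite (green_real l21 m11 k1 i1) ?g0 ?gl // (green_real l22 m12 k2 i2) ?g0 ?gl.
Qed.

Lemma dirichlet2_sym f f1 f2 g g1 g2 : dirichlet2 f f1 f2 -> dirichlet2 g g1 g2 ->
  rip f2 g = rip f g2.
Proof. by move=> df dg; rewrite (green df dg) ripC -(green dg df) ripC. Qed.

(** For a normalised eigenfunction [lam] is, by Green's formula, the sum of the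
    squared norm of the derivative and of [(p f, f)], which is at least [- K]. *)
Lemma eigenvalue_ge p (lam : R) f (K : R) : 0 <= K -> mfun01 p ->
  ae01 (fun x => `|p x| <= K) -> SL_graph p f (fun x => lam%:C * f x) ->
  nrm2 f = 1 -> - K <= lam.
Proof.
move=> K0 mp pK /[dup] /SL_graph_L2 lf /SL_graphP[y1 [y2 [d ag]]] n1.
have [[l1 l2] _ _ _ _] := d.
have lpf := L2_M mp pK lf.
have : rip (fun x => lam%:C * f x) f = lam by rewrite ripZl // -/(nrm2 f) n1 mulr1.
rewrite (rip_ae _ _ _ ag) //; [|exact: L2_Z|exact: L2_D (L2_N l2) lpf].
rewrite ripDl // ?ripNl //; last exact: L2_N.
rewrite (green d d) opprK => <-.
have := nrm2_ge0 y1; rewrite /nrm2.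
have := rip_le lpf lf; have := nrmM_le K0 mp pK lf.
rewrite /nrm n1 sqrtr1 !mulr1 => h1 h2; have := le_trans h2 h1.
rewrite ler_norml => /andP[]; lra.
Qed.

(** Symmetry of the operator, for the real and the imaginary part. *)
Lemma SL_graph_sym p f g h k (K : R) : mfun01 p -> ae01 (fun x => `|p x| <= K) ->
  L2_01 g -> L2_01 k -> SL_graph p f g -> SL_graph p h k ->
  rip g h = rip f k /\ rip g (fun x => 'i * h x) = rip f (fun x => 'i * k x).
Proof.
move=> mp pK lg lk /[dup] /SL_graph_L2 lf /SL_graphP[f1 [f2 [df af]]].
move=> /[dup] /SL_graph_L2 lh /SL_graphP[h1 [h2 [dh ah]]].
have [[lf1 lf2] _ _ _ _] := df; have [[lh1 lh2] _ _ _ _] := dh.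
have lpf := L2_M mp pK lf; have lph := L2_M mp pK lh.
have lN2 := L2_N lf2; have lM2 := L2_N lh2.
have lS := L2_D lN2 lpf; have lT := L2_D lM2 lph.
have E v : L2_01 v -> rip g v = - rip f2 v + rip (fun x => (p x)%:C * f x) v.
  by move=> lv; rewrite (rip_ae _ _ _ af) // ripDl // ripNl.
split.
  rewrite E // (dirichlet2_sym df dh) rip_mul (ripC f k) (rip_ae _ _ _ ah) // ripDl //.
  by rewrite ripNl // (ripC h2) (ripC _ f).
rewrite E; last exact: L2_i.
rewrite (dirichlet2_sym df (dirichlet2_i dh)) rip_mul.
have -> : rip f (fun x => 'i * k x) = - rip k (fun x => 'i * f x).
  by rewrite (ripC k) ripil // opprK.
have lif := L2_i lf.
rewrite (rip_ae _ _ _ ah) // ripDl // ripNl // opprD opprK.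
rewrite !(ripC _ (fun x => 'i * f x)) !ripil // opprK; congr (_ + _).
by congr rip; apply/funext => x; rewrite mulrCA.
Qed.

End SL.

(** * Differentiation in time *)

Section Time.
Variable R : realType.
Implicit Types (f g h : R -> R[i]) (p r P Q : R -> R) (T t s l e d : R) (u v : R -> R -> R[i]).
Local Notation mu := (@lebesgue_measure R).
Local Notation mfun01 := (measurable_fun (I01 : set (measurableTypeR R))).
Local Hint Resolve measurable_I01 : core.

Lemma is_derive_quot P t l :
  (forall e, 0 < e -> exists2 d, 0 < d &
    forall s, s != t -> `|s - t| < d -> `|(s - t)^-1 * (P s - P t) - l| <= e) ->
  is_derive t 1 P l.
Proof.
move=> H.
have C : h^-1 *: (P (h *: 1 + t) - P t) @[h --> 0^'] --> l.
  apply/cvgrPdist_le => e e0; have [d d0 Hd] := H e e0.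
  exists d => //= x; rewrite /ball_ /= sub0r normrN => xd x0.
  have := Hd (x + t); rewrite addrK scaler1 distrC; apply => //.
  by rewrite -subr_eq0 addrK.
by split; [apply/cvg_ex; exists l|apply/cvg_lim].
Qed.

(** At an interior time the filter of [0,T] punctured at [t] is that of a
    punctured neighbourhood, so derivatives relative to [0,T] are ordinary ones. *)
Lemma near_interior T t (S : R -> Prop) : 0 < t < T ->
  (\forall s \near within `[0, T] t^', S s) ->
  exists2 d, 0 < d & forall s, s != t -> `|s - t| < d -> 0 <= s <= T /\ S s.
Proof.
move=> /andP[t0 tT]; case=> d /= d0 H.
exists (Num.min d (Num.min t (T - t))); first by rewrite !lt_min d0 t0 subr_gt0.
move=> s st; rewrite !lt_min => /and3P[sd s1 s2].
have sT : 0 <= s <= T.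
  by move: s1 s2; rewrite !ltr_norml => /andP[a _] /andP[_ b]; apply/andP; split; lra.
by split => //; apply: H => //; rewrite /ball_ /= distrC.
Qed.

Lemma is_derive_cvg T t l P (q : R -> R) : 0 < t < T ->
  (forall s, 0 <= s <= T -> s != t -> `|(s - t)^-1 * (P s - P t) - l| <= q s) ->
  q s @[s --> within `[0, T] t^'] --> (0 : R) -> is_derive t 1 P l.
Proof.
move=> tT H /cvgrPdist_le C; apply: is_derive_quot => e e0.
have [d d0 Hd] := near_interior tT (C e e0).
exists d => // s st sd; have [sT] := Hd s st sd.
rewrite sub0r normrN => qe; apply: le_trans (H s sT st) _.
exact: le_trans (ler_norm _) qe.
Qed.

Lemma is_derive_complex T t (c : R -> R[i]) (l : R[i]) : 0 < t < T ->
  has_derivative_in T c t l ->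
  is_derive t 1 (fun s => complex.Re (c s)) (complex.Re l) /\
  is_derive t 1 (fun s => complex.Im (c s)) (complex.Im l).
Proof.
have leRe (z : R[i]) : `|complex.Re z| <= Normc.normc z.
  by case: z => a b /=; rewrite -sqrtr_sqr ler_wsqrtr // lerDl sqr_ge0.
have leIm (z : R[i]) : `|complex.Im z| <= Normc.normc z.
  by case: z => a b /=; rewrite -sqrtr_sqr ler_wsqrtr // lerDr sqr_ge0.
move=> tT H; split; apply: (is_derive_cvg tT _ H) => s sT st.
  apply: le_trans (leRe _); rewrite le_eqVlt; apply/orP; left; apply/eqP; congr (`|_|).
  by case: (c s) (c t) (l) => ? ? [? ?] [? ?] /=; ring.
apply: le_trans (leIm _); rewrite le_eqVlt; apply/orP; left; apply/eqP; congr (`|_|).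
by case: (c s) (c t) (l) => ? ? [? ?] [? ?] /=; ring.
Qed.

Lemma is_derive_rip T t u v h : 0 < t < T ->
  (forall s, 0 <= s <= T -> L2_01 (u s)) -> (forall s, 0 <= s <= T -> L2_01 (v s)) ->
  L2_01 h -> derivative_L2 T u v -> is_derive t 1 (fun s => rip (u s) h) (rip (v t) h).
Proof.
move=> tT lu lv lh /(_ t) H; have [t0 t1] := andP tT.
have tT' : 0 <= t <= T by rewrite !ltW.
have D : nrm (fun x => ((s - t)^-1)%:C * (u s x - u t x) - v t x) * nrm h
   @[s --> within `[0, T] t^'] --> (0 : R).
  rewrite -[X in _ --> X](mul0r (nrm h)); apply: cvgMl; apply: L2_norm_cvg (H tT').
  near=> s; apply: L2_B; last exact: lv.
  apply: L2_Z; apply: L2_B; apply: lu => //.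
  have : `[0, T]%classic s by near: s; exact: withinT.
  by rewrite /= in_itv.
apply: (is_derive_cvg tT _ D) => s sT st.
have ls := lu s sT; have lt := lu t tT'; have lvt := lv t tT'.
have lst := L2_B ls lt.
have lst' := L2_Z ((s - t)^-1) lst.
apply: le_trans (rip_le _ lh); last exact: L2_B.
by rewrite ripBl // ripZl // ripBl.
Unshelve. all: by end_near. Qed.

(** Limits under the derivative: [P] is differentiable at [t] with derivative
    [r t] when it is a uniform limit of functions whose derivatives converge
    uniformly to [r], and [r] is continuous at [t]. *)
Lemma derive_approx T t P r : 0 < t < T ->
  (forall e, 0 < e -> exists Q dQ : R -> R, [/\
     forall s, 0 <= s <= T -> `|Q s - P s| <= e,
     {within `[0, T], continuous Q}
   & forall s, 0 < s < T -> is_derive s 1 Q (dQ s) /\ `|dQ s - r s| <= e]) ->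
  (r s @[s --> within `[0, T] (nbhs t)] --> r t) ->
  is_derive t 1 P (r t).
Proof.
move=> tT H rt; have [t0 t1] := andP tT.
apply: is_derive_quot => e e0; have e3 : 0 < e / 3 by rewrite divr_gt0.
have rt' : \forall s \near within `[0, T] t^', `|r t - r s| <= e / 3.
  move/cvgrPdist_le : rt => /(_ _ e3) [d d0 Hd]; exists d => // s sd st; exact: Hd.
have [d d0 Hd] := near_interior tT rt'.
exists d => // s st sd.
have [sT _] := Hd s st sd.
have st0 : 0 < `|s - t| by rewrite normr_gt0 subr_eq0.
pose ep := Num.min (e / 3) (e * `|s - t| / 6).
have ep0 : 0 < ep by rewrite lt_min e3 divr_gt0 // mulr_gt0.
have [Q [dQ [QP cQ QD]]] := H ep ep0.
(* The mean value theorem applied to Q, on either side of t. *)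
have [c cst cE] : exists2 c, (0 < c < T /\ `|c - t| < d) & Q s - Q t = dQ c * (s - t).
  have sub a b : 0 <= a -> b <= T -> {within `[a, b], continuous Q}.
    move=> a0 bT; apply: continuous_subspaceW cQ.
    by move=> z; rewrite /= !in_itv /= => /andP[z1 z2];
      rewrite (le_trans a0 z1) (le_trans z2 bT).
  have [s0 s1] := andP sT.
  case: (ltgtP s t) st => // [lst|gst] _.
    have [||c] := @MVT R Q dQ s t lst.
    - by move=> x; rewrite in_itv /= => /andP[x1 x2]; apply: (proj1 (QD _ _));
      rewrite (le_lt_trans s0 x1) (lt_trans x2 t1).
    - by apply: sub => //; exact: ltW.
    rewrite in_itv /= => /andP[c1 c2] E; exists c.
      split; first by rewrite (le_lt_trans s0 c1) (lt_trans c2 t1).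
      move: sd; rewrite !ltr_norml => /andP[a b]; apply/andP; split; lra.
    by move: E; lra.
  have [||c] := @MVT R Q dQ t s gst.
  - by move=> x; rewrite in_itv /= => /andP[x1 x2]; apply: (proj1 (QD _ _));
    rewrite (lt_trans t0 x1) (lt_le_trans x2 s1).
  - by apply: sub => //; exact: ltW.
  rewrite in_itv /= => /andP[c1 c2] E; exists c => //.
  split; first by rewrite (lt_trans t0 c1) (lt_le_trans c2 s1).
  move: sd; rewrite !ltr_norml => /andP[a b]; apply/andP; split; lra.
case: cst => cT cd.
have h1 : `|dQ c - r t| <= 2 * (e / 3).
  have [_ h] := QD c cT.
  have h' : `|r t - r c| <= e / 3.
    have [->|ct] := eqVneq c t; first by rewrite subrr normr0 ltW.
    by have [] := Hd c ct cd.
  have : ep <= e / 3 by rewrite ge_min lexx.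
  have := ler_distD (r c) (dQ c) (r t); rewrite (distrC (r c)); lra.
have h2 : `|(Q s - P s) - (Q t - P t)| <= e * `|s - t| / 3.
  have tT' : 0 <= t <= T by rewrite !ltW.
  have := QP s sT; have := QP t tT'; have := ler_normB (Q s - P s) (Q t - P t).
  have : ep <= e * `|s - t| / 6 by rewrite ge_min lexx orbT.
  lra.
have -> : (s - t)^-1 * (P s - P t) - r t = (dQ c - r t) - (s - t)^-1 * ((Q s - P s) - (Q t - P
  t)).
  have -> : (Q s - P s) - (Q t - P t) = dQ c * (s - t) - (P s - P t) by rewrite -cE; ring.
  by field; rewrite subr_eq0.
have h3 : `|(s - t)^-1 * ((Q s - P s) - (Q t - P t))| <= e / 3.
  rewrite normrM normfV mulrC ler_pdivrMr //; lra.
have := ler_normB (dQ c - r t) ((s - t)^-1 * ((Q s - P s) - (Q t - P t))); lra.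
Qed.

Lemma cont_nrm T (u : R -> R -> R[i]) t : continuous_L2 T u -> 0 <= t <= T ->
  nrm (fun x => u s x - u t x) @[s --> within `[0, T] (nbhs t)] --> (0 : R).
Proof.
move=> cu tT; have [lt Ht] := cu t tT; apply: L2_norm_cvg Ht.
near=> s; apply: L2_B => //.
have : `[0, T]%classic s by near: s; exact: withinT.
by rewrite /= in_itv => sT; have [] := cu s sT.
Unshelve. all: by end_near. Qed.

Lemma within_rip T u h : continuous_L2 T u -> L2_01 h ->
  {within `[0, T], continuous (fun s => rip (u s) h)}.
Proof.
move=> cu lh; apply/subspace_continuousP => t tT.
have tT' : 0 <= t <= T by move: tT; rewrite /= in_itv.
have [lt _] := cu t tT'.
have D : nrm (fun x => u s x - u t x) * nrm h
   @[s --> within `[0, T] (nbhs t)] --> (0 : R).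
  by rewrite -[X in _ --> X](mul0r (nrm h)); apply: cvgMl; exact: cont_nrm.
apply/cvgrPdist_le => e e0; move/cvgrPdist_le : D => /(_ e e0); rewrite !near_withinE.
apply: filterS => s H sT; have sT' : 0 <= s <= T by move: sT; rewrite /= in_itv.
have [ls _] := cu s sT'; have := H sT; rewrite sub0r normrN; apply: le_trans.
apply: le_trans (ler_norm _); rewrite distrC -ripBl //; apply: rip_le => //; exact: L2_B.
Qed.

Lemma within_nrm T u : continuous_L2 T u -> {within `[0, T], continuous (fun s => nrm (u s))}.
Proof.
move=> cu; apply/subspace_continuousP => t tT.
have tT' : 0 <= t <= T by move: tT; rewrite /= in_itv.
have [lt _] := cu t tT'.
have D := cont_nrm cu tT'.
apply/cvgrPdist_le => e e0; move/cvgrPdist_le : D => /(_ e e0); rewrite !near_withinE.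
apply: filterS => s H sT; have sT' : 0 <= s <= T by move: sT; rewrite /= in_itv.
have [ls _] := cu s sT'; have := H sT; rewrite sub0r normrN; apply: le_trans.
by apply: le_trans (ler_norm _); rewrite distrC nrm_dist.
Qed.

Lemma nrm_bounded T u : 0 <= T -> continuous_L2 T u ->
  exists2 K : R, 0 <= K & forall s, 0 <= s <= T -> nrm (u s) <= K.
Proof.
move=> T0 cu; have [c _ H] := EVT_max T0 (within_nrm cu).
by exists (nrm (u c)); [exact: nrm_ge0|move=> s sT; apply: H; rewrite in_itv].
Qed.

(** A measurable coefficient, essentially bounded by [K] on (0,1). *)
Definition bounded_coef (K : R) p := [/\ 0 <= K, mfun01 p & ae01 (fun x => `|p x| <= K)].

Lemma is_derive_sumr n (F : 'I_n -> R -> R) (dF : 'I_n -> R) t :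
  (forall i, is_derive t 1 (F i) (dF i)) ->
  is_derive t 1 (fun s => \sum_(i < n) F i s) (\sum_(i < n) dF i).
Proof.
move=> H; have := is_derive_sum H; congr is_derive.
by apply/funext => s; rewrite fct_sumE.
Qed.

(** * Extension of the weak equation to the operator domain *)

Section Extension.
Variables (T : R) (a b q : R -> R) (lam : nat -> R) (phi : nat -> R -> R[i]).
Variables (u ut : R -> R -> R[i]).
Hypothesis eb : eigenbasis q lam phi.
Hypothesis cu : continuous_L2 T u.
Hypothesis cut : continuous_L2 T ut.
Hypothesis we : wave_equation T a b q u ut.
Variables (Ka Kb Kq : R).
Hypothesis ba : bounded_coef Ka a.
Hypothesis bb : bounded_coef Kb b.
Hypothesis bq : bounded_coef Kq q.

Lemma eigenbasis_SL n : SL_graph q (phi n) (fun x => (lam n)%:C * phi n x).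
Proof. by case: eb. Qed.

Lemma eigenbasis_L2 n : L2_01 (phi n).
Proof. exact: SL_graph_L2 (eigenbasis_SL n). Qed.

Lemma eigenbasis_orthonormal : orthonormal (real_basis phi).
Proof. by case: eb => _ h _; apply: real_basis_orthonormal h; exact: eigenbasis_L2. Qed.

Lemma real_basis_SL j : SL_graph q (real_basis phi j) (fun x =>
  (lam j./2)%:C * real_basis phi j x).
Proof.
rewrite /real_basis; case: ifP => _; last exact: eigenbasis_SL.
have := SL_graph_i (eigenbasis_SL j./2); congr SL_graph.
by apply/funext => x; rewrite mulrCA.
Qed.

Lemma real_basis_L2 j : L2_01 (real_basis phi j).
Proof. by case: eigenbasis_orthonormal. Qed.

Lemma eigenbasis_ge n : - Kq <= lam n.
Proof.
case: bq => K0 mq qK; apply: (eigenvalue_ge K0 mq qK (eigenbasis_SL n)).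
have [_ /(_ n n)] : (true /\ forall m n, inner (phi m) (phi n) = (m == n)%:R) by case: eb.
by rewrite innerE eqxx => -[].
Qed.

Let Lu s : 0 <= s <= T -> L2_01 (u s). Proof. by move=> /cu[]. Qed.
Let Lut s : 0 <= s <= T -> L2_01 (ut s). Proof. by move=> /cut[]. Qed.

(** The equation tested on one basis function. *)
Lemma wave_real_basis t j : 0 < t < T ->
  is_derive t 1 (fun s => rip (ut s) (real_basis phi j))
    (- (lam j./2 * rip (u t) (real_basis phi j) +
      rip (fun x => (a x)%:C * u t x) (real_basis phi j)
       + rip (fun x => (b x)%:C * ut t x) (real_basis phi j))).
Proof.
move=> tT; have tT' : 0 <= t <= T by case/andP: tT => *; rewrite !ltW.
set n := j./2.
(* The sequence of iterates of the operator on the eigenfunction. *)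
pose G (m : nat) x := ((lam n) ^+ m)%:C * phi n x.
have GS m : SL_graph q (G m) (G m.+1).
  have := SL_graphZ ((lam n) ^+ m) (eigenbasis_SL n); congr SL_graph.
  by apply/funext => x; rewrite /G mulrA exprSr -rmorphM.
have := we GS tT'.
have -> : G 0%N = phi n by apply/funext => x; rewrite /G expr0 mul1r.
have -> : G 1%N = fun x => (lam n)%:C * phi n x by apply/funext => x; rewrite /G expr1.
have E : inner (u t) (fun x => (lam n)%:C * phi n x) = (lam n)%:C * inner (u t) (phi n).
  rewrite !innerE.
  have -> : (fun x => 'i * ((lam n)%:C * phi n x)) = (fun x => (lam n)%:C * ('i * phi n x)).
    by apply/funext => x; rewrite mulrCA.
  have lt := Lu tT'; have lp := eigenbasis_L2 n; have lip := L2_i lp.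
  rewrite !ripZr //.
  by congr Complex; ring.
rewrite E !innerE => /(is_derive_complex tT)[] /=.
have -> : (fun s => complex.Re (inner (ut s) (phi n))) = (fun s => rip (ut s) (phi n)).
  by apply/funext => s; rewrite innerE.
have -> : (fun s => complex.Im (inner (ut s) (phi n))) =
  (fun s => rip (ut s) (fun x => 'i * phi n x)).
  by apply/funext => s; rewrite innerE.
rewrite /real_basis -/n; case: ifP => _ H1 H2.
  by apply: is_derive_eq H2 _ => //; rewrite /=; ring.
by apply: is_derive_eq H1 _ => //; rewrite /=; ring.
Qed.

(** The equation tested on an arbitrary [f] of the domain of the operator,
    rather than of the domains of all its powers. With [S] the partial sums of
    the eigenfunction expansion, [L_q (S f) = S (L_q f)] by symmetry, so the
    equation tested on [S f] converges uniformly in time with its right-hand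
    side. *)
Lemma wave_domain t f g : 0 < t < T -> SL_graph q f g -> L2_01 g ->
  is_derive t 1 (fun s => rip (ut s) f)
    (- (rip (u t) g + rip (fun x => (a x)%:C * u t x) f
       + rip (fun x => (b x)%:C * ut t x) f)).
Proof.
move=> tT sfg lg; have lf := SL_graph_L2 sfg.
have T0 : 0 <= T by case/andP: tT => t0 t1; apply: ltW; exact: lt_trans t1.
have [Cu Cu0 uC] := nrm_bounded T0 cu; have [Cv Cv0 vC] := nrm_bounded T0 cut.
have [Ka0 ma aK] := ba; have [Kb0 mb bK] := bb; have [Kq0 mq qK] := bq.
have laf := L2_M ma aK lf; have lbf := L2_M mb bK lf.
pose r s := - (rip (u s) g + rip (u s) (fun x => (a x)%:C * f x) +
  rip (ut s) (fun x => (b x)%:C * f x)).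
rewrite !rip_mul; apply: (derive_approx tT (r := r)); last first.
  have tT' : `[0, T]%classic t by rewrite /= in_itv /=; case/andP: tT => *; rewrite !ltW.
  apply: cvgN; apply: cvgD; first apply: cvgD.
  - by have /subspace_continuousP := within_rip cu lg; apply.
  - by have /subspace_continuousP := within_rip cu laf; apply.
  - by have /subspace_continuousP := within_rip cut lbf; apply.
have le := real_basis_L2.
pose S h N x := \sum_(j < N) (rip h (real_basis phi j))%:C * real_basis phi j x.
have lS h N : L2_01 (S h N) by apply: L2_sum => i; exact: L2_Z.
have appr h e : L2_01 h -> 0 < e -> \forall N \near \oo, nrm (fun x => h x - S h N.*2 x) <= e.
  move=> lh e0.
  have := partial_sum_cvg eb eigenbasis_L2 lh => /cvgr0Pnorm_le /(_ e e0); apply: filterS => N.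
  rewrite ger0_norm ?nrm_ge0 //; congr (nrm _ <= _); apply/funext => x.
  by rewrite partial_sumE.
(* C e' bounds the errors made on ut and on the three terms of the right-hand
   side when f and g are approximated within e'. *)
move=> e e0; pose C := Cu + Cu * Ka + Cv * Kb + Cv + 1.
have C0 : 0 < C by rewrite ltr_wpDl // !addr_ge0 // mulr_ge0.
have eC0 : 0 < e / C by rewrite divr_gt0.
have [N [Nf Ng]] : exists N, nrm (fun x => f x - S f N.*2 x) <=
  e / C /\ nrm (fun x => g x - S g N.*2 x) <= e / C.
  have [N1 _ H1] := appr f _ lf eC0; have [N2 _ H2] := appr g _ lg eC0.
  by exists (maxn N1 N2); split; [apply: H1; exact: leq_maxl|apply: H2; exact: leq_maxr].
set M := N.*2 in Nf Ng.
have Sg (w h : R -> R[i]) : L2_01 h -> rip h (S w M) =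
  \sum_(j < M) rip w (real_basis phi j) * rip h (real_basis phi j).
  move=> lh; rewrite ripC rip_suml //; last by move=> j; exact: L2_Z.
  by apply: eq_bigr => j _; rewrite ripZl // (ripC _ h).
have gE j : rip g (real_basis phi j) = lam j./2 * rip f (real_basis phi j).
  have [-> _] := SL_graph_sym mq qK lg (L2_Z (lam j./2) (le j)) sfg (real_basis_SL j).
  by rewrite ripZr.
exists (fun s => \sum_(j < M) (rip f (real_basis phi j) *: rip (ut s) (real_basis phi j))),
  (fun s => - (rip (u s) (S g M) + rip (fun x => (a x)%:C * u s x) (S f M) +
    rip (fun x => (b x)%:C * ut s x) (S f M))).
have lM := lS f M; have lN := lS g M.
have eCC : Cu * (e / C) + Cu * (Ka * (e / C)) + Cv * (Kb * (e / C)) + Cv * (e / C) <= e.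
  have -> : Cu * (e / C) + Cu * (Ka * (e / C)) + Cv * (Kb * (e / C)) + Cv * (e / C)
     = (C - 1) * (e / C) by rewrite /C; ring.
  by rewrite mulrBl mulrCA divff ?gt_eqF // mulr1 mul1r gerBl ltW.
have eC1 := ltW eC0.
have p1 : 0 <= Cu * (e / C) by apply: mulr_ge0.
have p2 : 0 <= Cu * (Ka * (e / C)) by apply: mulr_ge0 => //; apply: mulr_ge0.
have p3 : 0 <= Cv * (Kb * (e / C)) by apply: mulr_ge0 => //; apply: mulr_ge0.
have p4 : 0 <= Cv * (e / C) by apply: mulr_ge0.
have dist (h h1 h2 : R -> R[i]) (K1 K2 : R) : L2_01 h -> L2_01 h1 -> L2_01 h2 -> nrm h <= K1 ->
    nrm (fun x => h1 x - h2 x) <= K2 -> `|rip h h2 - rip h h1| <= K1 * K2.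
  move=> lh lh1 lh2 hK1 hK2; rewrite distrC -ripBr //.
  by apply: le_trans (rip_le lh (L2_B lh1 lh2)) _; apply: ler_pM => //; exact: nrm_ge0.
split.
- move=> s sT; rewrite -Sg; last exact: Lut.
  apply: le_trans (dist _ _ _ _ _ (Lut sT) lf lM (vC s sT) Nf) _.
  by apply: le_trans eCC; rewrite lerDr !addr_ge0.
- have E : {in `[0, T]%classic, (fun s => rip (ut s) (S f M)) =1
      (fun s => \sum_(j < M) (rip f (real_basis phi j) *: rip (ut s) (real_basis phi j)))}.
    by move=> s; rewrite inE /= in_itv /= => sT; rewrite Sg //; exact: Lut.
  exact: subspace_eq_continuous E (within_rip cut lM).
move=> s sT; have sT' : 0 <= s <= T by case/andP: sT => *; rewrite !ltW.
have lu := Lu sT'; have lv := Lut sT'.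
have lau := L2_M ma aK lu; have lbv := L2_M mb bK lv.
split.
  have H : is_derive s 1 (fun s' => \sum_(j < M) (rip f (real_basis phi j) *: rip (ut s')
    (real_basis phi j)))
     (\sum_(j < M) (rip f (real_basis phi j) *: (- (lam j./2 * rip (u s) (real_basis phi j) +
       rip (fun x => (a x)%:C * u s x) (real_basis phi j)
       + rip (fun x => (b x)%:C * ut s x) (real_basis phi j))))).
    by apply: is_derive_sumr => j; apply: is_deriveZ; exact: wave_real_basis.
  apply: is_derive_eq H _; rewrite !Sg // -!big_split /= -sumrN.
  by apply: eq_bigr => j _; rewrite gE /GRing.scale /=; ring.
have d1 := dist _ _ _ _ _ lu lg lN (uC s sT') Ng.
have d2 : `|rip (fun x => (a x)%:C * u s x) (S f M) - rip (fun x => (a x)%:C * u s x) f| <=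
  Ka * Cu * (e / C).
  apply: (dist _ _ _ _ _ lau lf lM _ Nf); apply: le_trans (nrmM_le Ka0 ma aK lu) _.
  by apply: ler_wpM2l => //; exact: uC.
have d3 : `|rip (fun x => (b x)%:C * ut s x) (S f M) - rip (fun x => (b x)%:C * ut s x) f| <=
  Kb * Cv * (e / C).
  apply: (dist _ _ _ _ _ lbv lf lM _ Nf); apply: le_trans (nrmM_le Kb0 mb bK lv) _.
  by apply: ler_wpM2l => //; exact: vC.
rewrite /r -!rip_mul.
set A1 := rip (u s) g in d1 *; set A2 := rip (fun x => (a x)%:C * u s x) f in d2 *.
set A3 := rip (fun x => (b x)%:C * ut s x) f in d3 *.
set B1 := rip (u s) _ in d1 *; set B2 := rip (fun x => (a x)%:C * u s x) _ in d2 *.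
set B3 := rip (fun x => (b x)%:C * ut s x) _ in d3 *.
have -> : - (B1 + B2 + B3) - - (A1 + A2 + A3) = - ((B1 - A1) + (B2 - A2) + (B3 - A3)) by ring.
rewrite normrN.
apply: le_trans (ler_normD _ _) _.
apply: le_trans (lerD (le_trans (ler_normD _ _) (lerD d1 d2)) d3) _.
apply: le_trans eCC; rewrite -[leLHS]addr0; apply: lerD p4.
by rewrite (mulrA Cu Ka) (mulrC Cu Ka) (mulrA Cv Kb) (mulrC Cv Kb).
Qed.
End Extension.

Lemma eq_ler (x y : R) : x = y -> x <= y.
Proof. by move=> ->. Qed.

Lemma is_derive_expZ (k t : R) : is_derive t 1 (fun s => expR (k * s)) (k * expR (k * t)).
Proof.
have H1 : is_derive t 1 (fun s : R => k * s) k.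
  by apply: is_derive_eq (is_deriveZ k (is_derive_id t 1)) _; rewrite /GRing.scale /= mulr1.
have := @is_derive1_comp R expR (fun s => k * s) t _ _ (is_derive_expR (k * t)) H1.
move=> H; apply: (is_derive_eq H); rewrite /GRing.scale /= mulrC; ring.
Qed.

Lemma cvg_sumr (F : set_system R) {FF : Filter F} n (f : 'I_n -> R -> R) (l : 'I_n -> R) :
  (forall j, f j x @[x --> F] --> l j) ->
  \sum_(j < n) f j x @[x --> F] --> \sum_(j < n) l j.
Proof. by move=> H; apply: cvg_big => //; exact: add_continuous. Qed.

(** * The energy inequality *)

(** The coefficients [c j] of the difference of two solutions and [d j] of its
    modified velocity, with error terms [be j] and [ga j]; [nu j - M] is the
    [j]-th eigenvalue and [n t] a bound of the squared norm at time [t],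
    normalised by [m]. *)
Section Energy.
Variables (T M B D m : R) (N : nat) (nu : nat -> R) (c d be ga : nat -> R -> R) (n : R -> R).
Hypothesis T0 : 0 < T.
Hypothesis B0 : 0 <= B.
Hypothesis D0 : 0 <= D.
Hypothesis nu_ge1 : forall j, 1 <= nu j.
Hypothesis cc : forall j, {within `[0, T], continuous (c j)}.
Hypothesis cd : forall j, {within `[0, T], continuous (d j)}.
Hypothesis Dc : forall j t, 0 < t < T -> is_derive t 1 (c j) (d j t - be j t).
Hypothesis Dd : forall j t, 0 < t < T ->
  is_derive t 1 (d j) (- ((nu j - M) * c j t) - ga j t).
Hypothesis sc : forall t, 0 <= t <= T -> \sum_(j < N) c j t ^+ 2 <= n t.
Hypothesis sbe : forall t, 0 <= t <= T -> \sum_(j < N) be j t ^+ 2 <= B * n t.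
Hypothesis sga : forall t, 0 <= t <= T -> \sum_(j < N) ga j t ^+ 2 <= B * n t + D.

Let C := 1 + 3 * B + 2 * M ^+ 2.
Hypothesis nm : forall t, 0 <= t <= T -> n t <= m * expR ((1 + 2 * C) * t).

(** The weights turn the sum of the [d j t ^+ 2] into a partial sum of an
    H^{-1} norm, as suits an estimate of the position in L^2. *)
Let E t := \sum_(j < N) (c j t ^+ 2 + (nu j)^-1 * d j t ^+ 2).

Let C0 : 0 < C. Proof. rewrite /C; move: B0 (sqr_ge0 M) => h1 h2; lra. Qed.

Lemma energy_deriv t : 0 < t < T -> exists2 e, is_derive t 1 E e & e <= E t + C * (n t + 2 * D).
Proof.
move=> tT; have tT' : 0 <= t <= T by case/andP: tT => *; rewrite !ltW.
exists (\sum_(j < N) (2 * c j t * (d j t - be j t) +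
   (nu j)^-1 * (2 * d j t * (- ((nu j - M) * c j t) - ga j t)))).
  apply: is_derive_sumr => j.
  have H1 := Dc j tT; have H2 := Dd j tT.
  have G1 := is_deriveM H1 H1; have G2 := is_deriveZ (nu j)^-1 (is_deriveM H2 H2).
  have := is_deriveD G1 G2.
  have -> : (c j * c j + (nu j)^-1 \*: (d j * d j))%R =
    (fun s => c j s ^+ 2 + (nu j)^-1 * d j s ^+ 2).
    by apply/funext => s; rewrite /= !expr2.
  move=> H; apply: (is_derive_eq H); rewrite /GRing.scale /=; ring.
have key (j : 'I_N) : 2 * c j t * (d j t - be j t) +
   (nu j)^-1 * (2 * d j t * (- ((nu j - M) * c j t) - ga j t)) <=
   (c j t ^+ 2 + (nu j)^-1 * d j t ^+ 2) + be j t ^+ 2 + 2 * M ^+ 2 * c j t ^+ 2 +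
     2 * ga j t ^+ 2.
  have m1 := nu_ge1 j; have mp : 0 < nu j := lt_le_trans ltr01 m1.
  set x := (nu j)^-1; have xm : x * nu j = 1 by rewrite mulVf // gt_eqF.
  have x0 : 0 < x by rewrite invr_gt0.
  have x1 : x <= 1 by rewrite invf_le1.
  have -> : 2 * c j t * (d j t - be j t) + x * (2 * d j t * (- ((nu j - M) * c j t) - ga j t)) =
     - 2 * c j t * be j t + 2 * (x * d j t) * (M * c j t - ga j t).
    have -> : x * (2 * d j t * (- ((nu j - M) * c j t) - ga j t)) =
      - (2 * d j t * c j t * (x * nu j)) + 2 * (x * d j t) * (M * c j t - ga j t) by ring.
    by rewrite xm; ring.
  have a1 := sqr_ge0 (c j t + be j t).
  have a2 := sqr_ge0 (x * d j t - (M * c j t - ga j t)).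
  have a3 := sqr_ge0 (M * c j t + ga j t).
  have a4 : (x * d j t) ^+ 2 <= x * d j t ^+ 2.
    rewrite exprMn expr2 -mulrA ler_piMl //; apply: mulr_ge0 (sqr_ge0 _); exact: ltW.
  have e1 : (c j t + be j t) ^+ 2 = c j t ^+ 2 + 2 * c j t * be j t + be j t ^+ 2 by ring.
  have e2 : (x * d j t - (M * c j t - ga j t)) ^+ 2 =
    (x * d j t) ^+ 2 - 2 * (x * d j t) * (M * c j t - ga j t) +
      (M * c j t - ga j t) ^+ 2 by ring.
  have e3 : (M * c j t + ga j t) ^+ 2 = 2 * M ^+ 2 * c j t ^+ 2 +
    2 * ga j t ^+ 2 - (M * c j t - ga j t) ^+ 2 by ring.
  rewrite e1 in a1; rewrite e2 in a2; rewrite e3 in a3; lra.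
apply: le_trans (ler_sum _ (fun j _ => key j)) _.
rewrite !big_split /= -big_split /= -/(E t) -!mulr_sumr.
have h1 := sc tT'; have h2 := sbe tT'; have h3 := sga tT'.
have n0 : 0 <= n t by apply: le_trans h1; apply: sumr_ge0 => j _; exact: sqr_ge0.
have h4 : 2 * M ^+ 2 * (\sum_(j < N) c j t ^+ 2) <= 2 * M ^+ 2 * n t.
  by apply: ler_wpM2l => //; apply: mulr_ge0 => //; exact: sqr_ge0.
have h5 : 0 <= 3 * B * D by rewrite !mulr_ge0.
have h6 : 0 <= M ^+ 2 * D by rewrite mulr_ge0 // sqr_ge0.
rewrite /C; lra.
Qed.

(** The exponential rate [1 + 2 * C] in the hypothesis on [n] is chosen so that
    the term [C * n t] of [energy_deriv] integrates to half of the bound of [n],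
    which leaves room for absorption. *)
Lemma energy_le t : 0 <= t <= T ->
  \sum_(j < N) c j t ^+ 2 <= expR t * (\sum_(j < N) c j 0 ^+ 2 + \sum_(j < N) d j 0 ^+ 2)
     + 2^-1 * (m + 2 * D) * expR ((1 + 2 * C) * t).
Proof.
move=> tT.
(* h is non-increasing, which is the integrated form of the inequality. *)
pose h s := expR (- 1 * s) * E s - 2^-1 * (m + 2 * D) * expR (2 * C * s).
have hD s : 0 < s < T -> exists2 e, is_derive s 1 h e & e <= 0.
  move=> sT; have [e De eE] := energy_deriv sT.
  have sT' : 0 <= s <= T by case/andP: sT => *; rewrite !ltW.
  exists (- expR (- 1 * s) * E s + expR (- 1 * s) * e - C * (m + 2 * D) * expR (2 * C * s)).
    have H := is_deriveD (is_deriveM (is_derive_expZ (-1) s) De) (is_deriveZ (- (2^-1 * (m +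
      2 * D))) (is_derive_expZ (2 * C) s)).
    have E1 : ((fun s => expR (- 1 * s)) * E + (- (2^-1 * (m +
      2 * D))) \*: (fun s => expR (2 * C * s)))%R = h.
      by apply/funext => z; rewrite /h -[in RHS]mulNr.
    rewrite E1 in H; apply: is_derive_eq H _; rewrite /GRing.scale /=; field; by [].
  have x0 := expR_gt0 (-1 * s).
  have x1 : expR (-1 * s) <= 1 by rewrite -[leRHS]expR0 ler_expR; case/andP: sT' => s0 s1; lra.
  have y1 : 1 <= expR (2 * C * s).
    rewrite -[leLHS]expR0 ler_expR; case/andP: sT' => s0 _; apply: mulr_ge0 => //;
      apply: mulr_ge0 => //; exact: ltW C0.
  have xn : expR (-1 * s) * n s <= m * expR (2 * C * s).
    apply: le_trans (ler_wpM2l (ltW x0) (nm sT')) _.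
    rewrite mulrCA -expRD; apply: eq_ler; congr (_ * expR _); ring.
  have xe : expR (-1 * s) * e <= expR (-1 * s) * E s + C * (expR (-1 * s) * n s +
    expR (-1 * s) * (2 * D)).
    apply: le_trans (ler_wpM2l (ltW x0) eE) _; apply: eq_ler; ring.
  have xd : expR (-1 * s) * (2 * D) <= 2 * D * expR (2 * C * s).
    rewrite mulrC; apply: ler_wpM2l; [exact: mulr_ge0|exact: le_trans x1 y1].
  have xc : C * (expR (-1 * s) * n s + expR (-1 * s) * (2 * D)) <=
    C * (m * expR (2 * C * s) + 2 * D * expR (2 * C * s)).
    by apply: ler_wpM2l; [exact: ltW|apply: lerD].
  have -> : C * (m + 2 * D) * expR (2 * C * s) =
    C * (m * expR (2 * C * s) + 2 * D * expR (2 * C * s)) by ring.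
  lra.
have cE : {within `[0, T], continuous E}.
  apply/subspace_continuousP => s sT.
  apply: cvg_sumr => j.
  have := @cc j; move/subspace_continuousP => /(_ s sT) h1.
  have := @cd j; move/subspace_continuousP => /(_ s sT) h2.
  apply: cvgD; first exact: (cvgM h1 h1).
  by apply: cvgMl_tmp; exact: (cvgM h2 h2).
have ch : {within `[0, T], continuous h}.
  have cexp k : {within `[0, T], continuous (fun s : R => expR (k * s))}.
    by apply: continuous_subspaceT => x; apply/differentiable_continuous/derivable1_diffP;
      case: (is_derive_expZ k x).
  apply/subspace_continuousP => s sT; apply: cvgB.
    apply: cvgM; first by have /subspace_continuousP := cexp (-1); apply.
    by have /subspace_continuousP := cE; apply.
  by apply: cvgMr; have /subspace_continuousP := cexp (2 * C); apply.
have [t0 t1] := andP tT.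
have : h t <= h 0.
  apply: (ler0_derive1_le_cc _ _ ch _ _ t0).
  - by move=> x; rewrite in_itv /= => /hD[e []].
  - by move=> x; rewrite in_itv /= => /hD[e [De He] le0]; rewrite derive1E He.
  - by rewrite in_itv.
  - by rewrite in_itv /= lexx ltW.
rewrite /h !mulr0 expR0 mul1r mulr1 => hh.
have EcE s : \sum_(j < N) c j s ^+ 2 <= E s.
  apply: ler_sum => j _; rewrite lerDl mulr_ge0 ?sqr_ge0 // invr_ge0;
    exact: le_trans (nu_ge1 j).
have E0 : E 0 <= \sum_(j < N) c j 0 ^+ 2 + \sum_(j < N) d j 0 ^+ 2.
  rewrite /E big_split /= lerD2l; apply: ler_sum => j _.
  by rewrite ler_piMl ?sqr_ge0 // invf_le1 // (lt_le_trans ltr01).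
apply: le_trans (EcE t) _.
have -> : E t = expR t * (expR (-1 * t) * E t) by rewrite mulrA -expRD mulN1r subrr expR0 mul1r.
have x0 := expR_gt0 t.
have m0 : 0 <= m.
  have TT : 0 <= (0 : R) <= T by rewrite lexx ltW.
  have := nm TT; rewrite mulr0 expR0 mulr1; apply: le_trans; apply: le_trans (sc TT).
  by apply: sumr_ge0 => j _; exact: sqr_ge0.
apply: (@le_trans _ _ (expR t * (E 0 + 2^-1 * (m + 2 * D) * expR (2 * C * t)))).
  apply: ler_wpM2l; first exact: ltW.
  move: hh; rewrite lerBlDr => /le_trans; apply.
  by rewrite -addrA lerD2l gerDr oppr_le0 mulr_ge0 // addr_ge0 // mulr_ge0.
rewrite mulrDr; apply: lerD; first by apply: ler_wpM2l; [exact: ltW|].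
rewrite mulrCA -expRD; apply: eq_ler; congr (_ * expR _); ring.
Qed.
End Energy.

End Time.

(** * Mollification *)

Section Mollification.
Variable R : realType.
Implicit Types (F w psi : R -> R) (x y e : R).
Local Notation mu := (@lebesgue_measure R).
Local Notation mfunT := (measurable_fun (setT : set (measurableTypeR R))).

Lemma measurable_convolution F w : mfunT F -> mfunT w ->
  mfunT (fun x => \int[mu]_y (F y * w (x - y))).
Proof.
move=> mF mw.
pose k (z : R * R) := (F z.2 * w (z.1 - z.2))%:E.
have mk : measurable_fun (setT : set (measurableTypeR R * measurableTypeR R)) k.
  apply/measurable_EFinP; apply: measurable_funM; first exact: (measurableT_comp mF).
  apply: (measurableT_comp mw); apply: measurable_funB;
    [exact: measurable_fst|exact: measurable_snd].
have -> : (fun x => \int[mu]_y (F y * w (x - y))) =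
    fine \o (fun x => \int[mu]_y k^\+ (x, y) - \int[mu]_y k^\- (x, y))%E.
  apply/funext => x; rewrite /Rintegral integralE /=.
  by congr (fine (_ - _)%E); apply: eq_integral => y _; rewrite ?funeposE ?funenegE.
apply: (measurableT_comp (fine_measurable measurableT)).
apply: emeasurable_funB.
  by apply: (@measurable_fun_fubini_tonelli_F _ _ _ _ _ mu (k^\+)%E) => //;
    exact: measurable_funepos.
by apply: (@measurable_fun_fubini_tonelli_F _ _ _ _ _ mu (k^\-)%E) => //;
  exact: measurable_funeneg.
Qed.

Lemma continuous_mfun w : continuous w -> mfunT w.
Proof. exact: continuous_measurable_fun. Qed.

(** The reflection [y |-> x - y] preserves the Lebesgue measure, because it does
    so on intervals. *)
Lemma integral_reflect (G : R -> R) x : mfunT G -> (forall z, 0 <= G z) ->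
  (\int[mu]_y (G (x - y))%:E = \int[mu]_y (G y)%:E)%E.
Proof.
move=> mG G0.
pose phi (y : measurableTypeR R) : measurableTypeR R := x - y.
have mphi : measurable_fun setT phi.
  by apply: (@continuous_mfun (fun y => x - y)) => y; apply: cvgB;
    [exact: cvg_cst|exact: cvg_id].
have E : forall A, measurable (A : set (measurableTypeR R)) -> mu A = pushforward mu phi A.
  apply: lebesgue_measure_unique => X [[a b] _ <-] /=.
  rewrite /pushforward lebesgue_measure_itv /=.
  have -> : phi @^-1` `]a, b]%classic = `[x - b, x - a[%classic.
    apply/seteqP; split=> y /=; rewrite !in_itv /= /phi => /andP[h1 h2]; apply/andP; split; lra.
  rewrite lebesgue_measure_itv /= !lte_fin ltrD2l ltrN2; case: ifP => // _.
  by rewrite -!EFinB; congr EFin; ring.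
rewrite -(@ge0_integral_pushforward _ _ _ _ R phi mphi mu setT (EFin \o G)) //.
- by apply: eq_measure_integral => A mA _; exact/esym/E.
- exact/measurable_EFinP.
- by move=> y _; rewrite lee_fin.
Qed.

Section Mollifier.
Variable psi : R -> R.
Hypothesis mpsi : mollifier psi.

Lemma mollifier_continuous : continuous psi.
Proof.
case: mpsi => sm _ _ _ x; apply/differentiable_continuous/derivable1_diffP.
exact: (sm 0%N x).
Qed.

Lemma mollifier_support : exists2 M : R, 0 < M & forall x, M <= `|x| -> psi x = 0.
Proof.
case: mpsi => _ [M HM] _ _; exists (`|M| + 1) => [|x Mx].
  by rewrite ltr_wpDl.
by apply: HM; apply: lt_le_trans Mx; rewrite ltr_pwDr // ler_norm.
Qed.

Lemma mollifier_ge0 x : 0 <= psi x. Proof. by case: mpsi. Qed.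

Lemma mollifier_bounded : exists2 K : R, 0 <= K & forall x, psi x <= K.
Proof.
have [M M0 HM] := mollifier_support.
have MM : - M <= M by lra.
have [c _ Hc] := EVT_max MM (continuous_subspaceT mollifier_continuous).
exists (psi c) => [|x]; first exact: mollifier_ge0.
case: (leP M `|x|) => h; first by rewrite HM // mollifier_ge0.
by apply: Hc; rewrite in_itv /= -ler_norml ltW.
Qed.

Lemma mollifier_int : (\int[mu]_x (psi x)%:E = 1)%E.
Proof.
case: mpsi => _ _ _; rewrite /Rintegral.
have : (0 <= \int[mu]_x (psi x)%:E)%E by apply: integral_ge0 => x _;
  rewrite lee_fin mollifier_ge0.
by case: (\int[mu]_x (psi x)%:E)%E => //= [r _ ->//|_ /eqP]; rewrite eq_sym oner_eq0.
Qed.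

Lemma dilation_ge0 e x : 0 < e -> 0 <= dilation psi e x.
Proof. by move=> e0; rewrite mulr_ge0 ?mollifier_ge0 // invr_ge0 ltW. Qed.

Lemma dilation_continuous e : continuous (dilation psi e).
Proof.
move=> x; apply: cvgMl_tmp; apply: continuous_comp; last exact: mollifier_continuous.
by apply: cvgMr_tmp; exact: cvg_id.
Qed.

(** Substitution of [(x - y) / e], which is increasing in [x]. *)
Lemma dilation_int e y : 0 < e -> (\int[mu]_x (dilation psi e (x - y))%:E = 1)%E.
Proof.
move=> e0; rewrite -mollifier_int.
pose F (x : R) := e^-1 * (x - y).
have dF x : is_derive x 1 F e^-1.
  have H := is_deriveZ e^-1 (is_deriveB (is_derive_id x 1) (is_derive_cst y x 1)).
  by apply: is_derive_eq H _; rewrite /GRing.scale /= subr0 mulr1.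
have F'E : derive1 F = cst e^-1 by apply/funext => x; rewrite derive1E; case: (dF x).
rewrite [RHS](@increasing_ge0_integration_by_substitutionT R F psi).
- apply: eq_integral => x _; rewrite F'E; congr EFin.
  change (e^-1 * psi ((x - y) / e) = psi (e^-1 * (x - y)) * e^-1).
  by rewrite mulrC [(x - y) / e]mulrC.
- by move=> x z xz; rewrite /F ltr_pM2l ?invr_gt0 // ltrD2r.
- by rewrite F'E; exact: cst_continuous.
- by rewrite F'E; apply: is_cvg_cst.
- by rewrite F'E; apply: is_cvg_cst.
- by move=> x; case: (dF x).
- apply/cvgrNyPle => A; near=> x.
  rewrite /F mulrC ler_pdivrMr // lerBlDr; near: x; apply: nbhs_ninfty_le; exact: num_real.
- apply/cvgryPge => A; near=> x.
  rewrite /F mulrC ler_pdivlMr // lerBrDr; near: x; apply: nbhs_pinfty_ge; exact: num_real.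
- exact: mollifier_continuous.
- exact: mollifier_ge0.
Unshelve. all: by end_near. Qed.

Lemma dilation_int_reflect e x : 0 < e -> (\int[mu]_y (dilation psi e (x - y))%:E = 1)%E.
Proof.
move=> e0; rewrite (@integral_reflect (dilation psi e)).
- by rewrite -(dilation_int 0 e0); apply: eq_integral => y _; rewrite subr0.
- by apply: continuous_mfun; exact: dilation_continuous.
- by move=> z; exact: dilation_ge0.
Qed.

Lemma dilation_le : exists2 K : R, 0 <= K & forall e x, 0 < e -> dilation psi e x <= e^-1 * K.
Proof.
have [K K0 HK] := mollifier_bounded; exists K => // e x e0.
by apply: ler_wpM2l; rewrite // invr_ge0 ltW.
Qed.

Lemma dilation_supp : exists2 M : R, 0 < M & forall e x,
  0 < e -> M * e <= `|x| -> dilation psi e x = 0.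
Proof.
have [M M0 HM] := mollifier_support; exists M => // e x e0 Mx.
by rewrite /dilation HM ?mulr0 // normrM normfV (gtr0_norm e0) ler_pdivlMr.
Qed.

End Mollifier.

Section Convolution.
Variable psi : R -> R.
Hypothesis mpsi : mollifier psi.
Variable F : R -> R.
Hypothesis mF : mfunT F.
Hypothesis iF : mu.-integrable setT (EFin \o (fun x => F x ^+ 2)).

(** The mollification [F * psi_e] of [F]. *)
Definition mollify e x : R := \int[mu]_y (F y * dilation psi e (x - y)).

(** The kernel of the mollification, a probability density in [y]. *)
Let wgt e x y := dilation psi e (x - y).

Let mw e x : mfunT (wgt e x).
Proof.
apply: continuous_mfun => y; rewrite /wgt.
apply: (@continuous_comp _ _ _ (fun y => x - y) (dilation psi e));
  last exact: dilation_continuous.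
by apply: cvgB; [exact: cvg_cst|exact: cvg_id].
Qed.

Let iw e x : 0 < e -> mu.-integrable setT (EFin \o wgt e x).
Proof.
move=> e0; apply/integrableP; split; first exact/measurable_EFinP.
rewrite (_ : (\int[mu]_y _)%E = (\int[mu]_y (wgt e x y)%:E)%E); last first.
  by apply: eq_integral => y _ /=; rewrite ger0_norm // dilation_ge0.
by rewrite dilation_int_reflect // ltry.
Qed.

Let iFFw e x : 0 < e -> mu.-integrable setT (EFin \o (fun y => F y ^+ 2 * wgt e x y)).
Proof.
move=> e0; have [K K0 HK] := dilation_le mpsi.
have := integrableZl measurableT (e^-1 * K) iF; apply: le_integrable => //.
  by apply/measurable_EFinP; apply: measurable_funM => //; exact: measurable_funX.
move=> y _; have w0 : 0 <= wgt e x y := dilation_ge0 mpsi _ e0.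
have wK : wgt e x y <= e^-1 * K := HK e (x - y) e0.
rewrite /= lee_fin normrM [leRHS]normrM mulrC; apply: ler_wpM2r => //.
by rewrite (ger0_norm w0) (ger0_norm (le_trans w0 wK)).
Qed.

Let iFw e x : 0 < e -> mu.-integrable setT (EFin \o (fun y => F y * wgt e x y)).
Proof.
move=> e0; have := integrableD measurableT (iw x e0) (iFFw x e0).
apply: le_integrable => //.
  by apply/measurable_EFinP; exact: measurable_funM.
move=> y _.
change (`|F y * wgt e x y|%:E <= `|wgt e x y + F y ^+ 2 * wgt e x y|%:E)%E.
rewrite lee_fin.
have w0 : 0 <= wgt e x y by exact: dilation_ge0.
have -> : wgt e x y + F y ^+ 2 * wgt e x y = (1 + F y ^+ 2) * wgt e x y by ring.
rewrite !normrM ler_wpM2r // [leRHS]ger0_norm ?addr_ge0 ?sqr_ge0 //.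
have := sqr_ge0 (`|F y| - 1); rewrite -(real_normK (num_real (F y))) sqrrB1.
have := normr_ge0 (F y) => h1 h2; lra.
Qed.

Lemma measurable_mollify e : mfunT (mollify e).
Proof.
apply: measurable_convolution => //; apply: continuous_mfun; exact: dilation_continuous.
Qed.

Let intw e x : 0 < e -> \int[mu]_y wgt e x y = 1.
Proof. by move=> e0; rewrite /Rintegral dilation_int_reflect. Qed.

(** Jensen's inequality for the square, from the integral of
    [(F y - mollify e x)^2] against the kernel being non-negative. *)
Lemma mollify_jensen e x : 0 < e ->
  ((mollify e x ^+ 2)%:E <= \int[mu]_y (F y ^+ 2 * dilation psi e (x - y))%:E)%E.
Proof.
move=> e0; set c := mollify e x.
have i2 := iFFw x e0; have i1 := iFw x e0; have i0 := iw x e0.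
have j1 : mu.-integrable setT (EFin \o (fun y => (2 * c) * (F y * wgt e x y))).
  exact: (integrableZl measurableT (2 * c) i1).
have j0 : mu.-integrable setT (EFin \o (fun y => c ^+ 2 * wgt e x y)).
  exact: (integrableZl measurableT (c ^+ 2) i0).
have j2 : mu.-integrable setT (EFin \o (fun y =>
  F y ^+ 2 * wgt e x y - (2 * c) * (F y * wgt e x y))).
  exact: (integrableB measurableT i2 j1).
have : 0 <= \int[mu]_y (F y ^+ 2 * wgt e x y - (2 * c) * (F y * wgt e x y) +
  c ^+ 2 * wgt e x y).
  apply: Rintegral_ge0 => y _.
  have -> : F y ^+ 2 * wgt e x y - (2 * c) * (F y * wgt e x y) + c ^+ 2 * wgt e x y =
    (F y - c) ^+ 2 * wgt e x y by ring.
  by rewrite mulr_ge0 ?sqr_ge0 // dilation_ge0.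
rewrite RintegralD // RintegralB // RintegralZl // RintegralZl // intw //.
rewrite -/(mollify e x) -/c => H.
rewrite -(@fineK _ (\int[mu]_y _)%E); last exact: integrable_fin_num i2.
rewrite lee_fin -/(Rintegral mu setT (fun y => F y ^+ 2 * wgt e x y)).
move: H; set I := Rintegral _ _ _; move=> H; lra.
Qed.

(** Mollification is a contraction of L^2: Jensen, then Tonelli. *)
Lemma mollify_contraction e : 0 < e ->
  (\int[mu]_x (mollify e x ^+ 2)%:E <= \int[mu]_x (F x ^+ 2)%:E)%E.
Proof.
move=> e0.
pose k (z : R * R) := (F z.2 ^+ 2 * dilation psi e (z.1 - z.2))%:E.
have mk : measurable_fun (setT : set (measurableTypeR R * measurableTypeR R)) k.
  apply/measurable_EFinP; apply: measurable_funM.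
    apply: (measurableT_comp (f := fun y => F y ^+ 2)); last exact: measurable_snd.
    exact: measurable_funX.
  apply: (measurableT_comp (f := dilation psi e)).
    by apply: continuous_mfun; exact: dilation_continuous.
  by apply: measurable_funB; [exact: measurable_fst|exact: measurable_snd].
have k0 z : (0 <= k z)%E by rewrite lee_fin mulr_ge0 ?sqr_ge0 // dilation_ge0.
apply: (@le_trans _ _ (\int[mu]_x \int[mu]_y k (x, y))%E).
  apply: ge0_le_integral => //.
  - by move=> x _; rewrite lee_fin sqr_ge0.
  - by apply/measurable_EFinP/measurable_funX; exact: measurable_mollify.
  - exact: (@measurable_fun_fubini_tonelli_F _ _ _ _ _ mu k).
  - by move=> x _; exact: mollify_jensen.
rewrite fubini_tonelli //.
rewrite le_eqVlt; apply/orP; left; apply/eqP; apply: eq_integral => y _.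
under eq_integral do rewrite /k /= EFinM.
rewrite ge0_integralZl //.
- by rewrite dilation_int // mule1.
- apply/measurable_EFinP.
  apply: continuous_mfun => x.
  apply: (@continuous_comp _ _ _ (fun x => x - y) (dilation psi e));
    last exact: dilation_continuous.
  by apply: cvgB; [exact: cvg_id|exact: cvg_cst].
- by move=> x _; rewrite lee_fin dilation_ge0.
- by rewrite lee_fin sqr_ge0.
Qed.

Lemma L2_locally_integrable : locally_integrable setT F.
Proof.
split => //; first exact: openT.
move=> K _ cK; have mK : measurable (K : set (measurableTypeR R)) by exact: compact_measurable.
apply: (@le_lt_trans _ _ (\int[mu]_(x in K) (1 + F x ^+ 2)%:E)%E).
  apply: ge0_le_integral => //.
  - by apply/measurable_EFinP/measurableT_comp => //; exact: measurable_funS mF.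
  - apply/measurable_EFinP; apply: measurable_funD => //; apply: measurable_funX.
    exact: measurable_funS mF.
  - move=> x _; rewrite lee_fin.
    have := sqr_ge0 (`|F x| - 1); rewrite -(real_normK (num_real (F x))) sqrrB1.
    have := normr_ge0 (F x) => h1 h2; lra.
have mFK : measurable_fun (K : set (measurableTypeR R)) (fun x => (F x ^+ 2)%:E).
  by apply/measurable_EFinP; apply: measurable_funX; exact: measurable_funS mF.
under eq_integral do rewrite EFinD.
rewrite ge0_integralD //; last by move=> x _; rewrite lee_fin sqr_ge0.
apply: lte_add_pinfty; first by rewrite integral_cst // mul1e; exact: compact_finite_measure.
have /integrableP[_] := integrableS measurableT mK (@subsetT _ K) iF.
apply: le_lt_trans; apply: ge0_le_integral => //.
- by move=> x _; rewrite lee_fin sqr_ge0.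
- exact: measurableT_comp.
- by move=> x _ /=; rewrite lee_fin ler_norm.
Qed.

(** If [psi <= K] and [psi] vanishes outside the ball of radius [M], the
    difference at [x] is at most [2 * M * K] times the mean oscillation of [F]
    around [x] over the ball of radius [M * e]. *)
Lemma mollify_lebesgue_pt x : lebesgue_pt F x -> mollify e x @[e --> 0^'+] --> F x.
Proof.
have [K K0 HK] := dilation_le mpsi; have [M M0 HM] := dilation_supp mpsi.
move=> /fine_cvgP[Lf L].
have bnd e : 0 < e -> (`|mollify e x - F x|%:E <= (2 * M * K)%:E * davg F x (M * e))%E.
  move=> e0; have i1 := iFw x e0; have i0 := iw x e0.
  have j0 : mu.-integrable setT (EFin \o (fun y => F x * wgt e x y)).
    exact: (integrableZl measurableT (F x) i0).
  have ij := integrableB measurableT i1 j0.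
  have -> : mollify e x - F x = \int[mu]_y (F y * wgt e x y - F x * wgt e x y).
    by rewrite RintegralB // RintegralZl // intw // mulr1.
  rewrite EFin_normr_Rintegral //.
  apply: le_trans (le_abse_integral mu measurableT (measurable_int mu ij)) _.
  have Me : 0 < M * e by rewrite mulr_gt0.
  have mb : measurable (ball x (M * e) : set (measurableTypeR R)) by exact: measurable_ball.
  have mFx : mfunT (fun y => F y - F x) by apply: measurable_funB.
  apply: (@le_trans _ _ (\int[mu]_(y in ball x (M * e)) ((e^-1 * K)%:E * `|F y - F x|%:E))%E).
    rewrite [leRHS]integral_mkcond; apply: ge0_le_integral => //.
    - by apply: measurableT_comp => //; exact: (measurable_int mu ij).
    - apply/(measurable_restrictT _ mb) => //; apply: measurable_funeM.
      apply/measurable_EFinP; apply: measurableT_comp => //; exact: measurable_funS mFx.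
    move=> y _; rewrite /= patchE.
    have -> : F y * wgt e x y - F x * wgt e x y = wgt e x y * (F y - F x) by ring.
    case: ifPn => yb.
      rewrite -EFinM lee_fin normrM; apply: ler_wpM2r => //.
      by rewrite ger0_norm ?HK // dilation_ge0.
    rewrite /wgt HM // ?mul0r ?normr0 //.
    by move: yb; rewrite notin_setE /ball /= => /negP; rewrite -leNgt.
  rewrite ge0_integralZl //; last first.
  - by rewrite lee_fin mulr_ge0 // invr_ge0 ltW.
  - by apply/measurable_EFinP; apply: measurableT_comp => //; exact: measurable_funS mFx.
  rewrite /davg /iavg /= lebesgue_measure_ball ?(ltW Me) // muleA; apply: lee_wpmul2r.
    exact: integral_ge0.
  rewrite inver ifF; last by rewrite mulrn_eq0 /= gt_eqF.
  rewrite -EFinM lee_fin; apply: eq_ler; rewrite -[M * e *+ 2]mulr_natl; field.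
  by rewrite !gt_eqF.
apply/cvgrPdist_le => d d0.
have C0 : 0 < 2 * M * K + 1 by rewrite ltr_wpDl // mulr_ge0 // mulr_ge0 // ltW.
move/cvgrPdist_le : L => /(_ (d / (2 * M * K + 1))); rewrite divr_gt0 // => /(_ isT) L.
have [r r0 Hr] := filterI Lf L.
exists (r / M) => /=; first by rewrite divr_gt0.
move=> e; rewrite /ball_ /= sub0r normrN => er e0.
have Me : 0 < M * e by rewrite mulr_gt0.
have [] := Hr (M * e) _ Me.
  by rewrite /ball_ /= sub0r normrN gtr0_norm // mulrC -ltr_pdivlMr // -(gtr0_norm e0).
move=> fn; rewrite /= sub0r normrN => h.
have := bnd e e0; rewrite -(fineK fn) -EFinM lee_fin distrC => /le_trans; apply.
apply: (@le_trans _ _ ((2 * M * K) * (d / (2 * M * K + 1)))).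
  apply: ler_wpM2l; first by rewrite mulr_ge0 // mulr_ge0 // ltW.
  exact: le_trans (ler_norm _) h.
rewrite mulrA ler_pdivrMr // mulrC ler_wpM2l ?(ltW d0) //; lra.
Qed.

(** With [I] the integral of [F^2], the parallelogram identity and
    [mollify_contraction] bound the integrals of [(F_e - F)^2] and
    [(F_e + F)^2] by [4 * I] in total, while by Fatou's lemma the second has
    inferior limit at least [4 * I]. *)
Lemma mollify_cvg_L2 :
  (\int[mu]_x (((mollify e x - F x) ^+ 2)%:E))%E @[e --> 0^'+] --> 0%E.
Proof.
have fI : (\int[mu]_x (F x ^+ 2)%:E)%E \is a fin_num by exact: integrable_fin_num iF.
set I := (\int[mu]_x (F x ^+ 2)%:E)%E in fI.
have mc := measurable_mollify.
have par e : 0 < e -> (\int[mu]_x ((mollify e x - F x) ^+ 2)%:E +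
    \int[mu]_x ((mollify e x + F x) ^+ 2)%:E <= 4%:E * I)%E.
  move=> e0.
  have mm : mfunT (fun x => (mollify e x - F x) ^+ 2) by apply/measurable_funX/measurable_funB.
  have mp : mfunT (fun x => (mollify e x + F x) ^+ 2) by apply/measurable_funX/measurable_funD.
  have m1 : mfunT (fun x => (mollify e x) ^+ 2) by apply/measurable_funX.
  have m2 : mfunT (fun x => (F x) ^+ 2) by apply/measurable_funX.
  rewrite -ge0_integralD //=; try by [move=> x _;
    rewrite lee_fin sqr_ge0|exact/measurable_EFinP].
  apply: (@le_trans _ _ (\int[mu]_x (2%:E * ((mollify e x ^+ 2)%:E + (F x ^+ 2)%:E)))%E).
    rewrite le_eqVlt; apply/orP; left; apply/eqP; apply: eq_integral => x _.
    by rewrite -!EFinD -EFinM; congr EFin; ring.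
  rewrite ge0_integralZl //=; first last.
  - by move=> x _; rewrite adde_ge0 // lee_fin sqr_ge0.
  - by apply: emeasurable_funD; exact/measurable_EFinP.
  rewrite ge0_integralD //=; try by [move=> x _;
    rewrite lee_fin sqr_ge0|exact/measurable_EFinP].
  have -> : (4%:E * I = 2%:E * (I + I))%E.
    by rewrite -(fineK fI) -EFinD -!EFinM; congr EFin; ring.
  by apply: lee_wpmul2l => //; apply: leeD => //; exact: mollify_contraction.
pose D e := (\int[mu]_x ((mollify e x - F x) ^+ 2)%:E)%E.
pose S e := (\int[mu]_x ((mollify e x + F x) ^+ 2)%:E)%E.
have D0 e : (0 <= D e)%E by apply: integral_ge0 => x _; rewrite lee_fin sqr_ge0.
have S0 e : (0 <= S e)%E by apply: integral_ge0 => x _; rewrite lee_fin sqr_ge0.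
have f4I : (4%:E * I)%E \is a fin_num by rewrite fin_numM.
have fD e : 0 < e -> D e \is a fin_num.
  move=> e0; rewrite ge0_fin_numE //; apply: (@le_lt_trans _ _ (4%:E * I)%E);
    last by rewrite -ge0_fin_numE // mule_ge0 // integral_ge0 // => x _;
      rewrite lee_fin sqr_ge0.
  by apply: le_trans (par e e0); apply: leeDl; exact: S0.
have fS e : 0 < e -> S e \is a fin_num.
  move=> e0; rewrite ge0_fin_numE //; apply: (@le_lt_trans _ _ (4%:E * I)%E);
    last by rewrite -ge0_fin_numE // mule_ge0 // integral_ge0 // => x _;
      rewrite lee_fin sqr_ge0.
  by apply: le_trans (par e e0); apply: leeDr; exact: D0.
apply/fine_cvgP; split.
  near=> e; apply: fD; near: e; exact: nbhs_right_gt.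
apply/cvg_at_rightP => u [u0 uc].
have fat : (4%:E * I <= limn_einf (S \o u))%E.
  have mf n : measurable_fun (setT : set (measurableTypeR R)) (fun x => ((mollify (u n) x +
    F x) ^+ 2)%:E).
    by apply/measurable_EFinP/measurable_funX/measurable_funD.
  have f0 n (x : R) : [set: R] x -> (0 <= ((mollify (u n) x + F x) ^+ 2)%:E)%E.
    by move=> _; rewrite lee_fin sqr_ge0.
  apply: le_trans (fatou mu measurableT mf f0).
  rewrite -ge0_integralZl //; last 2 first.
  - by apply/measurable_EFinP; apply: measurable_funX.
  - by move=> x _; rewrite lee_fin sqr_ge0.
  rewrite le_eqVlt; apply/orP; left; apply/eqP; apply: ae_eq_integral => //.
  - by apply: measurable_funeM; apply/measurable_EFinP; apply: measurable_funX.
  - apply: measurableT_comp => //; apply: measurable_fun_limn_esup => n.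
    exact: measurableT_comp.
  have := lebesgue_differentiation L2_locally_integrable.
  apply: (@filterS _ _ (ae_filter_ringOfSetsType mu)) => x /mollify_lebesgue_pt cx _.
  have cux : mollify (u n) x @[n --> \oo] --> F x by move/cvg_at_rightP : cx; apply; split.
  apply/esym.
  have C : (fun n => ((mollify (u n) x + F x) ^+ 2)%:E) n @[n --> \oo] --> (4%:E * (F x ^+
    2)%:E)%E.
    rewrite -EFinM; apply/fine_cvgP; split; first exact: nearW.
    have -> : 4 * F x ^+ 2 = (F x + F x) * (F x + F x) by ring.
    have cs : mollify (u n) x + F x @[n --> \oo] --> F x + F x by apply: cvgD => //;
      exact: cvg_cst.
    exact: (cvgM cs cs).
  by rewrite (cvg_limn_einf_sup C).1.
move: fat; rewrite limn_einf_lim (cvg_lim _ (cvg_einfs_sup (u := S \o u))) // => fat.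
apply/cvgrPdist_le => e e0.
have : (4%:E * I - e%:E < ereal_sup (range (einfs (S \o u))))%E.
  by apply: lt_le_trans fat; rewrite lteBlDr // lteDl // lte_fin.
move=> /ereal_sup_gt[_ [n0 _ <-] Hn0]; exists n0 => // n /= n0n.
rewrite sub0r normrN ger0_norm; last exact: fine_ge0 (D0 (u n)).
have h1 : (einfs (S \o u) n0 <= S (u n))%E.
  by apply: ereal_inf_lbound; exists n.
have h2 : (4%:E * I - e%:E < S (u n))%E := lt_le_trans Hn0 h1.
have h3 := par _ (u0 n); rewrite -/(D (u n)) -/(S (u n)) in h3.
move: h2 h3; rewrite -(fineK (fD _ (u0 n))) -(fineK (fS _ (u0 n))) -(fineK f4I).
rewrite -EFinB -EFinD lte_fin lee_fin => h2 h3; lra.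
Unshelve. all: by end_near. Qed.
End Convolution.

End Mollification.

(** * Comparison of two solutions *)

Section Comparison.
Variable R : realType.
Implicit Types (f g h : R -> R[i]) (p r : R -> R) (K t s e : R).
Local Notation mu := (@lebesgue_measure R).
Local Notation mfun01 := (measurable_fun (I01 : set (measurableTypeR R))).
Local Hint Resolve measurable_I01 : core.

Lemma ler_sqr_ge0 (x y : R) : 0 <= x -> x <= y -> x ^+ 2 <= y ^+ 2.
Proof. by move=> x0 xy; rewrite ler_sqr // nnegrE // (le_trans x0). Qed.

Lemma bounded_coefD p r K L : bounded_coef K p -> bounded_coef L r ->
  bounded_coef (K + L) (fun x => p x + r x).
Proof.
move=> [K0 mp pK] [L0 mr rL]; split; [exact: addr_ge0|exact: measurable_funD|].
by apply: ae01S (ae01I pK rL) => x _ [h1 h2]; exact: le_trans (ler_normD _ _) (lerD h1 h2).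
Qed.

Lemma bounded_coef_sub p r K L : bounded_coef K p -> bounded_coef L (fun x => r x - p x) ->
  bounded_coef (K + L) r.
Proof.
move=> h1 h2; have := bounded_coefD h1 h2; congr bounded_coef.
by apply/funext => x; rewrite addrC subrK.
Qed.

Lemma bounded_coef_L2 p K f : bounded_coef K p -> L2_01 f -> L2_01 (fun x => (p x)%:C * f x).
Proof. by case=> _ mp pK; exact: L2_M mp pK. Qed.

Lemma bounded_coef_nrm2 p K f : bounded_coef K p -> L2_01 f ->
  nrm2 (fun x => (p x)%:C * f x) <= K ^+ 2 * nrm2 f.
Proof. by case=> K0 mp pK; exact: nrm2M_le. Qed.

(** The domain of the operator does not depend on the potential. *)
Lemma SL_graph_perturb p r f g : SL_graph p f g ->
  SL_graph r f (fun x => g x + (r x - p x)%:C * f x).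
Proof.
move=> /SL_graphP[y1 [y2 [d ag]]]; apply/SL_graphP; exists y1, y2; split => //.
by apply: ae01S ag => x _ ->; rewrite rmorphB /=; ring.
Qed.

Lemma within_nrmB T (u v : R -> R -> R[i]) : continuous_L2 T u -> continuous_L2 T v ->
  {within `[0, T], continuous (fun s => nrm (fun x => v s x - u s x))}.
Proof.
move=> cu cv; apply/subspace_continuousP => t tT.
have tT' : 0 <= t <= T by move: tT; rewrite /= in_itv.
have [lu _] := cu t tT'; have [lv _] := cv t tT'.
have D0 : nrm (fun x => v s x - v t x) + nrm (fun x => u s x - u t x)
    @[s --> within `[0, T] (nbhs t)] --> (0 : R).
  by rewrite -[X in _ --> X]addr0; apply: cvgD; exact: cont_nrm.
move/cvgrPdist_le : D0 => D; apply/cvgrPdist_le => e e0; have := D e e0; rewrite !near_withinE.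
apply: filterS => s H sT; have sT' : 0 <= s <= T by move: sT; rewrite /= in_itv.
have [lus _] := cu s sT'; have [lvs _] := cv s sT'.
have := H sT; rewrite sub0r normrN; apply: le_trans; apply: le_trans (ler_norm _).
have := nrm_dist (L2_B lvs lus) (L2_B lv lu); rewrite distrC => /le_trans; apply.
have -> : (fun x => v s x - u s x - (v t x - u t x)) =
  (fun x => (v s x - v t x) - (u s x - u t x)).
  by apply/funext => x; ring.
by apply: nrmB; apply: L2_B.
Qed.

(** The last step of the Gronwall argument, for [m] the maximum over [0,T] of
    the squared norm divided by an exponential, [X] the value of that
    exponential where the maximum is reached, and [Y] a slower one. *)
Lemma gronwall_absorb (m E D X Y : R) : 0 < X -> Y <= X -> 0 <= E ->
  m * X <= Y * E + 2^-1 * (m + 2 * D) * X -> m <= 2 * E + 2 * D.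
Proof.
move=> X0 YX E0 h; have h2 : m * X <= (E + 2^-1 * (m + 2 * D)) * X.
  apply: le_trans h _; rewrite [leRHS]mulrDl lerD2r mulrC; exact: ler_wpM2l.
move: h2; rewrite ler_pM2r // => h2; lra.
Qed.

(** The exponential growth factor of the comparison estimate, for coefficients
    [a], [b], [q] bounded by [Ka], [Kb], [Kq]: [expR ((1 + 2 * C) * T)] with the
    [C] of the energy inequality. *)
Definition growth Ka Kb Kq T : R :=
  expR ((1 + 2 * (1 + 3 * ((Kb + 1) ^+ 2 + 2 * (Ka + 2) ^+ 2) + 2 * (Kq + 1) ^+ 2)) * T).

(** Two solutions [u] and [u'], whose coefficients are within [de] of each other
    and whose initial data are within [rho] in squared norm. *)
Section Fixed.
Variables (T : R) (a b q a' b' q' : R -> R).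
Variables (lam lam' : nat -> R) (phi phi' : nat -> R -> R[i]).
Variables (u ut u' ut' : R -> R -> R[i]).
Hypothesis T0 : 0 < T.
Hypothesis eb : eigenbasis q lam phi.
Hypothesis eb' : eigenbasis q' lam' phi'.
Hypothesis cu : continuous_L2 T u.
Hypothesis cut : continuous_L2 T ut.
Hypothesis du : derivative_L2 T u ut.
Hypothesis we : wave_equation T a b q u ut.
Hypothesis cu' : continuous_L2 T u'.
Hypothesis cut' : continuous_L2 T ut'.
Hypothesis du' : derivative_L2 T u' ut'.
Hypothesis we' : wave_equation T a' b' q' u' ut'.
Variables (Ka Kb Kq de Cu Cv rho : R).
Hypothesis ba : bounded_coef Ka a.
Hypothesis bb : bounded_coef Kb b.
Hypothesis bq : bounded_coef Kq q.
Hypothesis da : bounded_coef de (fun x => a' x - a x).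
Hypothesis db : bounded_coef de (fun x => b' x - b x).
Hypothesis dq : bounded_coef de (fun x => q' x - q x).
Hypothesis de1 : de <= 1.
Hypothesis uC : forall s, 0 <= s <= T -> nrm (u s) <= Cu.
Hypothesis vC : forall s, 0 <= s <= T -> nrm (ut s) <= Cv.

Let w s x := u' s x - u s x.
Let wt s x := ut' s x - ut s x.

Hypothesis w0 : nrm2 (w 0) <= rho.
Hypothesis wt0 : nrm2 (wt 0) <= rho.

Let lu s : 0 <= s <= T -> L2_01 (u s). Proof. by move=> /cu[]. Qed.
Let lut s : 0 <= s <= T -> L2_01 (ut s). Proof. by move=> /cut[]. Qed.
Let lu' s : 0 <= s <= T -> L2_01 (u' s). Proof. by move=> /cu'[]. Qed.
Let lut' s : 0 <= s <= T -> L2_01 (ut' s). Proof. by move=> /cut'[]. Qed.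
Let lw s : 0 <= s <= T -> L2_01 (w s).
Proof. by move=> sT; apply: L2_B; [exact: lu'|exact: lu]. Qed.
Let lwt s : 0 <= s <= T -> L2_01 (wt s).
Proof. by move=> sT; apply: L2_B; [exact: lut'|exact: lut]. Qed.

Let ba' : bounded_coef (Ka + de) a'. Proof. exact: bounded_coef_sub ba da. Qed.
Let bb' : bounded_coef (Kb + de) b'. Proof. exact: bounded_coef_sub bb db. Qed.
Let bq' : bounded_coef (Kq + de) q'. Proof. exact: bounded_coef_sub bq dq. Qed.

Let e j := real_basis phi j.
Let le j : L2_01 (e j). Proof. exact: (real_basis_L2 eb). Qed.
Let oe : orthonormal e. Proof. exact: (eigenbasis_orthonormal eb). Qed.

(** The products with [e j] are taken separately on [u] and [u'], because a
    derivative involves a function of all real times, while linearity of [rip]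
    is available only at times of [0,T], where the functions are in L^2. The
    second summand of [d] is [(b' * w, e j)]. *)
Let c j s := rip (u' s) (e j) - rip (u s) (e j).
Let Be j x := (b' x)%:C * e j x.
Let d j s := (rip (ut' s) (e j) - rip (ut s) (e j)) + (rip (u' s) (Be j) - rip (u s) (Be j)).
Let Bw s x := (b' x)%:C * w s x.
Let G s x := (q' x - q x)%:C * u' s x + ((a' x)%:C * u' s x - (a x)%:C * u s x)
   + ((b' x)%:C * ut s x - (b x)%:C * ut s x).
Let be j s := rip (Bw s) (e j).
Let ga j s := rip (G s) (e j).

Let lBe j : L2_01 (Be j). Proof. exact: bounded_coef_L2 bb' (le j). Qed.
Let lBw s : 0 <= s <= T -> L2_01 (Bw s).
Proof. by move=> sT; exact: bounded_coef_L2 bb' (lw sT). Qed.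

Let cE j s : 0 <= s <= T -> c j s = rip (w s) (e j).
Proof. by move=> sT; rewrite /w ripBl; [|exact: lu'|exact: lu|exact: le]. Qed.

Let dE j s : 0 <= s <= T -> d j s = rip (fun x => wt s x + Bw s x) (e j).
Proof.
move=> sT; rewrite ripDl; [|exact: lwt|exact: lBw|exact: le].
rewrite /wt ripBl; [|exact: lut'|exact: lut|exact: le].
rewrite /Bw rip_mul /w ripBl; [by []|exact: lu'|exact: lu|exact: lBe].
Qed.

Let Dc j t : 0 < t < T -> is_derive t 1 (c j) (d j t - be j t).
Proof.
move=> tT; have tT' : 0 <= t <= T by case/andP: tT => *; rewrite !ltW.
have H := is_deriveB (is_derive_rip tT lu' lut' (le j) du') (is_derive_rip tT lu lut (le j) du).
apply: (is_derive_eq H); rewrite /d /be /Bw rip_mul /w ripBl;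
  [|exact: lu'|exact: lu|exact: lBe].
by rewrite addrK.
Qed.

Let lG s : 0 <= s <= T -> L2_01 (G s).
Proof.
move=> sT; apply: L2_D; first apply: L2_D; [|apply: L2_B|apply: L2_B].
- exact: bounded_coef_L2 dq (lu' sT).
- exact: bounded_coef_L2 ba' (lu' sT).
- exact: bounded_coef_L2 ba (lu sT).
- exact: bounded_coef_L2 bb' (lut sT).
- exact: bounded_coef_L2 bb (lut sT).
Qed.

Let gaE j s : 0 <= s <= T -> ga j s =
   rip (u' s) (fun x => (q' x - q x)%:C * e j x)
   + (rip (fun x => (a' x)%:C * u' s x) (e j) - rip (fun x => (a x)%:C * u s x) (e j))
   + (rip (ut s) (Be j) - rip (fun x => (b x)%:C * ut s x) (e j)).
Proof.
move=> sT.
have l1 := bounded_coef_L2 dq (lu' sT); have l2 := bounded_coef_L2 ba' (lu' sT).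
have l3 := bounded_coef_L2 ba (lu sT); have l4 := bounded_coef_L2 bb' (lut sT);
  have l5 := bounded_coef_L2 bb (lut sT).
have l23 := L2_B l2 l3; have l45 := L2_B l4 l5; have l123 := L2_D l1 l23.
rewrite /ga /G (ripDl l123 l45 (le j)) (ripDl l1 l23 (le j)) (ripBl l2 l3 (le j)) (ripBl l4 l5
  (le j)).
by rewrite (rip_mul (fun x => q' x - q x)) (rip_mul b').
Qed.

Let M := Kq + 1.
Let nu j := lam j./2 + M.

(** The equation of [u'] is tested on [e j], which is in the domain of its
    operator; the derivative of [(b' * w, e j)] cancels the damping [b' * w_t]. *)
Let Dd j t : 0 < t < T -> is_derive t 1 (d j) (- ((nu j - M) * c j t) - ga j t).
Proof.
move=> tT; have tT' : 0 <= t <= T by case/andP: tT => *; rewrite !ltW.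
have sg := SL_graph_perturb q' (real_basis_SL eb j).
have l1 : L2_01 (fun x => (lam j./2)%:C * e j x) := L2_Z _ (le j).
have l2 := bounded_coef_L2 dq (le j).
have H1 := wave_domain eb' cu' cut' we' ba' bb' bq' tT sg (L2_D l1 l2).
have H2 := wave_real_basis eb cu we j tT.
have H3 := is_derive_rip tT lu' lut' (lBe j) du'.
have H4 := is_derive_rip tT lu lut (lBe j) du.
have H := is_deriveD (is_deriveB H1 H2) (is_deriveB H3 H4).
apply: (is_derive_eq H); rewrite (gaE j tT') /c.
rewrite (ripDr l1 l2 (lu' tT')) (ripZr _ (le j) (lu' tT')) (rip_mul b') -/(Be j) /nu addrK /e.
ring.
Qed.

Let KB := Kb + 1.
Let KA := Ka + 2.
Let B := KB ^+ 2 + 2 * KA ^+ 2.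
Let D := 4 * ((2 * de) ^+ 2 * Cu ^+ 2) + 4 * (de ^+ 2 * Cv ^+ 2).

Let de0 : 0 <= de. Proof. by case: da. Qed.
Let Ka0 : 0 <= Ka. Proof. by case: ba. Qed.
Let Kb0 : 0 <= Kb. Proof. by case: bb. Qed.

Let Bw_le s : 0 <= s <= T -> nrm2 (Bw s) <= KB ^+ 2 * nrm2 (w s).
Proof.
move=> sT; apply: le_trans (bounded_coef_nrm2 bb' (lw sT)) _; apply: ler_wpM2r;
  first exact: nrm2_ge0.
by apply: ler_sqr_ge0; [exact: addr_ge0|rewrite /KB lerD2l].
Qed.

Let G_le s : 0 <= s <= T -> nrm2 (G s) <= 2 * KA ^+ 2 * nrm2 (w s) + D.
Proof.
move=> sT.
have bA : bounded_coef (de + (Ka + de)) (fun x => (q' x - q x) + a' x) := bounded_coefD dq ba'.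
have bAa : bounded_coef (de + de) (fun x => (q' x - q x) + (a' x - a x)) := bounded_coefD dq da.
have l1 := bounded_coef_L2 bA (lw sT); have l2 := bounded_coef_L2 bAa (lu sT);
  have l3 := bounded_coef_L2 db (lut sT).
(* In terms of w, u and ut the coefficients of u and ut are differences of
   coefficients, hence small. *)
have -> : G s = (fun x => ((q' x - q x) + a' x)%:C * w s x +
   (((q' x - q x) + (a' x - a x))%:C * u s x + (b' x - b x)%:C * ut s x)).
  by apply/funext => x; rewrite /G /w !(rmorphB, rmorphD) /=; ring.
apply: le_trans (nrm2D_le l1 (L2_D l2 l3)) _.
have h1 := bounded_coef_nrm2 bA (lw sT).
have h2 := bounded_coef_nrm2 bAa (lu sT).
have h3 := bounded_coef_nrm2 db (lut sT).
have h4 := nrm2D_le l2 l3.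
have h5 : (de + (Ka + de)) ^+ 2 * nrm2 (w s) <= KA ^+ 2 * nrm2 (w s).
  apply: ler_wpM2r; first exact: nrm2_ge0.
  apply: ler_sqr_ge0; first by apply: addr_ge0 => //; exact: addr_ge0.
  by rewrite /KA addrCA lerD2l; exact: (lerD de1 de1).
have h6 : (de + de) ^+ 2 * nrm2 (u s) <= (2 * de) ^+ 2 * Cu ^+ 2.
  rewrite (_ : de + de = 2 * de); last by ring.
  by apply: ler_wpM2l; [exact: sqr_ge0|exact: sqr_nrm_le (uC sT)].
have h7 : de ^+ 2 * nrm2 (ut s) <= de ^+ 2 * Cv ^+ 2.
  by apply: ler_wpM2l; [exact: sqr_ge0|exact: sqr_nrm_le (vC sT)].
rewrite /D -mulrA.
have h8 := lerD (ler_wpM2l (ler0n R 2) (le_trans h1 h5)) (ler_wpM2l (ler0n R 2) h4).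
apply: le_trans h8 _; rewrite lerD2l.
have h9 := lerD (ler_wpM2l (ler0n R 2) (le_trans h2 h6)) (ler_wpM2l (ler0n R 2) (le_trans h3
  h7)).
apply: le_trans (ler_wpM2l (ler0n R 2) h9) _; apply: eq_ler; ring.
Qed.

Let n s := nrm2 (w s).

Let B0 : 0 <= B.
Proof. by apply: addr_ge0; [exact: sqr_ge0|apply: mulr_ge0 => //; exact: sqr_ge0]. Qed.
Let D0 : 0 <= D.
Proof. by apply: addr_ge0; apply: mulr_ge0 => //; apply: mulr_ge0; exact: sqr_ge0. Qed.

Let sc N s : 0 <= s <= T -> \sum_(j < N) c j s ^+ 2 <= n s.
Proof.
move=> sT; under eq_bigr => j _ do rewrite (cE _ sT).
exact: bessel oe (lw sT).
Qed.

Let sbe N s : 0 <= s <= T -> \sum_(j < N) be j s ^+ 2 <= B * n s.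
Proof.
move=> sT; apply: le_trans (bessel N oe (lBw sT)) _.
apply: le_trans (Bw_le sT) _; apply: ler_wpM2r; first exact: nrm2_ge0.
by rewrite /B lerDl; apply: mulr_ge0 => //; exact: sqr_ge0.
Qed.

Let sga N s : 0 <= s <= T -> \sum_(j < N) ga j s ^+ 2 <= B * n s + D.
Proof.
move=> sT; apply: le_trans (bessel N oe (lG sT)) _.
apply: le_trans (G_le sT) _; rewrite lerD2r; apply: ler_wpM2r; first exact: nrm2_ge0.
by rewrite /B lerDr; exact: sqr_ge0.
Qed.

Let nu_ge1 j : 1 <= nu j.
Proof. by rewrite /nu /M addrA lerDr -lerBlDr sub0r; exact: (eigenbasis_ge eb bq). Qed.

Let cc j : {within `[0, T], continuous (c j)}.
Proof.
apply/subspace_continuousP => s sT; apply: cvgB.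
  by have /subspace_continuousP := within_rip cu' (le j); apply.
by have /subspace_continuousP := within_rip cu (le j); apply.
Qed.

Let cd j : {within `[0, T], continuous (d j)}.
Proof.
apply/subspace_continuousP => s sT; apply: cvgD; apply: cvgB.
- by have /subspace_continuousP := within_rip cut' (le j); apply.
- by have /subspace_continuousP := within_rip cut (le j); apply.
- by have /subspace_continuousP := within_rip cu' (lBe j); apply.
- by have /subspace_continuousP := within_rip cu (lBe j); apply.
Qed.

Let E0 := (3 + 2 * KB ^+ 2) * rho.

Let init N : \sum_(j < N) c j 0 ^+ 2 + \sum_(j < N) d j 0 ^+ 2 <= E0.
Proof.
have TT : 0 <= (0 : R) <= T by rewrite lexx ltW.
have h1 := le_trans (sc N TT) w0.
have h2 : \sum_(j < N) d j 0 ^+ 2 <= 2 * rho + 2 * (KB ^+ 2 * rho).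
  under eq_bigr => j _ do rewrite (dE _ TT).
  apply: le_trans (bessel N oe (L2_D (lwt TT) (lBw TT))) _.
  apply: le_trans (nrm2D_le (lwt TT) (lBw TT)) _; apply: lerD; apply: ler_wpM2l => //.
  by apply: le_trans (Bw_le TT) _; apply: ler_wpM2l w0; exact: sqr_ge0.
apply: le_trans (lerD h1 h2) _; apply: eq_ler; rewrite /E0; ring.
Qed.

Let C := 1 + 3 * B + 2 * M ^+ 2.

Let C0 : 0 <= C.
Proof.
apply: addr_ge0; first apply: addr_ge0 => //; apply: mulr_ge0 => //; exact: sqr_ge0.
Qed.

(** The factor [m] is taken as an attained maximum, so that the bound of [n] is
    an equality at some time. *)
Let n_max : exists m, [/\ forall s, 0 <= s <= T -> n s <= m * expR ((1 + 2 * C) * s)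
   & exists2 t, 0 <= t <= T & n t = m * expR ((1 + 2 * C) * t)].
Proof.
pose k := 1 + 2 * C.
have ch : {within `[0, T], continuous (fun s => expR (- k * s) * (nrm (w s) * nrm (w s)))}.
  apply/subspace_continuousP => s sT; apply: cvgM.
    have : {within `[0, T], continuous (fun s : R => expR (- k * s))}.
      by apply: continuous_subspaceT => x; apply/differentiable_continuous/derivable1_diffP;
        case: (is_derive_expZ (- k) x).
    by move/subspace_continuousP; apply.
  have /subspace_continuousP h := within_nrmB cu cu'.
  exact: (cvgM (h s sT) (h s sT)).
have [t tT Ht] := EVT_max (ltW T0) ch.
have nE s : expR (- k * s) * (nrm (w s) * nrm (w s)) = expR (- k * s) * n s.
  by rewrite -expr2 sqr_nrm.
have inv s : expR (- k * s) * expR (k * s) = 1 by rewrite -expRD mulNr addNr expR0.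
exists (expR (- k * t) * n t); split => [s sT|].
  have := Ht s; rewrite in_itv /= => /(_ sT); rewrite !nE => h.
  have := ler_wpM2r (expR_ge0 (k * s)) h; apply: le_trans.
  by rewrite mulrAC inv mul1r.
exists t; first by move: tT; rewrite in_itv.
by rewrite -/k mulrAC inv mul1r.
Qed.

(** Continuous dependence in L^2 on the coefficients and the data, with a
    constant that depends on [T], on bounds of the coefficients [a], [b], [q] and
    on bounds of [u] and its time derivative, but not on [u']. *)
Lemma wave_comparison t : 0 <= t <= T ->
  nrm2 (fun x => u' t x - u t x) <=
    (2 * ((3 + 2 * (Kb + 1) ^+ 2) * rho)
       + 2 * (4 * ((2 * de) ^+ 2 * Cu ^+ 2) + 4 * (de ^+ 2 * Cv ^+ 2)))
    * growth Ka Kb Kq T.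
Proof.
rewrite -/KB -/E0 -/D /growth -/KB -/KA -/B -/M -/C.
have [m [nm [t0 t0T nE]]] := n_max.
have EN s : 0 <= s <= T -> n s <= expR s * E0 + 2^-1 * (m + 2 * D) * expR ((1 + 2 * C) * s).
  move=> sT; apply: (parseval_le eb (eigenbasis_L2 eb) (lw sT)) => N.
  have := energy_le T0 B0 D0 nu_ge1 cc cd Dc Dd (@sc N) (@sbe N) (@sga N) nm sT.
  rewrite -/C; under eq_bigr => j _ do rewrite (cE _ sT).
  move=> h; apply: le_trans h _; rewrite lerD2r; apply: ler_wpM2l;
    [exact: expR_ge0|exact: init].
have E00 : 0 <= E0.
  rewrite /E0 mulr_ge0 //; last exact: le_trans (nrm2_ge0 _) w0.
  by apply: addr_ge0 => //; apply: mulr_ge0 => //; exact: sqr_ge0.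
have k1 : 1 <= 1 + 2 * C by rewrite lerDl; apply: mulr_ge0.
have mle : m <= 2 * E0 + 2 * D.
  have := EN t0 t0T; rewrite nE; apply: gronwall_absorb => //; first exact: expR_gt0.
  rewrite ler_expR -[leLHS]mul1r; apply: ler_wpM2r => //.
  by case/andP: t0T.
move=> tT; apply: le_trans (nm t tT) _.
have DE : 0 <= 2 * E0 + 2 * D by apply: addr_ge0; apply: mulr_ge0.
apply: ler_pM => //; last first.
  rewrite ler_expR; apply: ler_wpM2l; first exact: le_trans ler01 k1.
  by case/andP: tT.
rewrite -(pmulr_lge0 _ (expR_gt0 ((1 + 2 * C) * t0))) -nE; exact: nrm2_ge0.
Qed.
End Fixed.

(** * Regularised coefficients and initial data *)

Lemma Linf_le p K : (Linf_norm p <= K%:E)%E -> ae01 (fun x => `|p x| <= K).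
Proof.
rewrite /Linf_norm unlock /Lnorm ifT; last first.
  by apply: (@lt_le_trans _ _ (mu I01)); rewrite ?le_measure ?inE // /I01 lebesgue_measure_itv
    /= lte_fin ltr01 -EFinB lte_fin subr0.
move=> /ess_supP; rewrite /ae01; apply: (@filterS _ _ (ae_filter_ringOfSetsType mu)) => x /=.
by move=> h Ix; move: h; rewrite patchE mem_set // lee_fin.
Qed.

Lemma Linf_bounded_coef p : Linf01 p -> exists K, bounded_coef K p.
Proof.
rewrite /Linf01 inE => /andP[]; rewrite !inE /= /finite_norm => mp np.
have n0 : (0 <= 'N[mu]_+oo%E[EFin \o (p \_ I01)])%E by exact: Lnorm_ge0.
exists (fine ('N[mu]_+oo%E[EFin \o (p \_ I01)])%E); split; first exact: fine_ge0.
  exact: ((measurable_restrictT _ (@measurable_I01 R)).2 mp).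
by apply: Linf_le; rewrite fineK // ge0_fin_numE.
Qed.

Lemma regularising_measurable p (pe : R -> R -> R) s :
  regularising_coef p pe -> 0 < s <= 1 -> mfun01 (pe s).
Proof.
move=> [psi [F [mpsi]]]; rewrite inE => /andP[]; rewrite !inE /= => mF _ _ H s1.
have -> : pe s = (fun x => \int[mu]_y (F y * dilation psi s (x - y))).
  by apply/funext => x; exact: H.
apply: measurable_funTS; apply: measurable_convolution => //.
by apply: continuous_mfun; exact: dilation_continuous.
Qed.

Lemma near_Linf (f : R -> R -> R) d : 0 < d ->
  Linf_norm (f s) @[s --> 0^'+] --> 0%E ->
  \forall s \near 0^'+, (Linf_norm (f s) <= d%:E)%E.
Proof.
move=> d0 /fine_cvgP[ff /cvgrPdist_le /(_ d d0)] H.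
apply: filterS2 ff H => s fs; rewrite sub0r normrN => h.
rewrite -(fineK fs) lee_fin; exact: le_trans (ler_norm _) h.
Qed.

Lemma Lfun2_sqr_integrable (F : R -> R) : F \in Lfun mu 2%:E ->
  measurable_fun (setT : set (measurableTypeR R)) F /\
  mu.-integrable setT (EFin \o (fun x => F x ^+ 2)).
Proof.
move=> lF; split; last exact: Lfun2_integrable_sqr.
by move: lF; rewrite inE => /andP[]; rewrite !inE.
Qed.

(** Convergence of the mollified data, in the squared norm of any representative
    [g] of the difference on (0,1). *)
Lemma regularising_data_small f (fe : R -> R -> R[i]) d : regularising_data f fe -> 0 < d ->
  \forall s \near 0^'+, forall g, L2_01 g ->
    ae01 (fun x => g x = fe s x - f x) -> nrm2 g <= d.
Proof.
move=> [psi [F [mpsi [F1 F2] Ff H]]] d0.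
have [m1 i1] := Lfun2_sqr_integrable F1; have [m2 i2] := Lfun2_sqr_integrable F2.
have d2 : 0 < d / 2 by rewrite divr_gt0.
have small (P : R -> R) : measurable_fun (setT : set (measurableTypeR R)) P ->
  mu.-integrable setT (EFin \o (fun x => P x ^+ 2)) ->
  \forall s \near 0^'+, (\int[mu]_x (((mollify psi P s x - P x) ^+ 2)%:E) <= (d / 2)%:E)%E.
  move=> mP iP; have /fine_cvgP[ff /cvgrPdist_le /(_ _ d2)] := mollify_cvg_L2 mpsi mP iP.
  apply: filterS2 ff => s fs; rewrite sub0r normrN => h.
  by rewrite -(fineK fs) lee_fin; exact: le_trans (ler_norm _) h.
have s1 : \forall s \near (0 : R)^'+, 0 < s <= 1.
  near=> s; apply/andP; split; near: s; [exact: nbhs_right_gt|exact: nbhs_right_le].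
near=> s => g lg ge.
have s01 : 0 < s <= 1 by near: s.
have n1 : (\int[mu]_x (((mollify psi (fun x => complex.Re (F x)) s x - complex.Re (F x)) ^+
  2)%:E) <= (d / 2)%:E)%E.
  by near: s; exact: small.
have n2 : (\int[mu]_x (((mollify psi (fun x => complex.Im (F x)) s x - complex.Im (F x)) ^+
  2)%:E) <= (d / 2)%:E)%E.
  by near: s; exact: small.
set P1 := fun x => mollify psi (fun x => complex.Re (F x)) s x - complex.Re (F x) in n1.
set P2 := fun x => mollify psi (fun x => complex.Im (F x)) s x - complex.Im (F x) in n2.
have mP1 : measurable_fun (setT : set (measurableTypeR R)) P1.
  by apply: measurable_funB => //; exact: measurable_mollify.
have mP2 : measurable_fun (setT : set (measurableTypeR R)) P2.
  by apply: measurable_funB => //; exact: measurable_mollify.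
have gP : ae01 (fun x => rp (g x) (g x) = P1 x ^+ 2 + P2 x ^+ 2).
  apply: ae01S (ae01I ge Ff) => x _ [-> <-].
  have -> : fe s x = mollify psi (fun x => complex.Re (F x)) s x +i* mollify psi (fun x =>
    complex.Im (F x)) s x.
    rewrite H // /cint /mollify; congr Complex; apply: eq_Rintegral => y _;
      case: (F y) => v1 v2 /=; ring.
  by rewrite /P1 /P2 /rp; case: (F x) => v1 v2 /=; ring.
have fing : (\int[mu]_(x in I01) (rp (g x) (g x))%:E)%E \is a fin_num.
  by apply: integrable_fin_num => //; have := rip_int lg lg.
rewrite -lee_fin /nrm2 /rip /Rintegral fineK //.
have mQ1 : measurable_fun (setT : set (measurableTypeR R)) (fun x => (P1 x ^+ 2)%:E).
  by apply/measurable_EFinP; exact: measurable_funX.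
have mQ2 : measurable_fun (setT : set (measurableTypeR R)) (fun x => (P2 x ^+ 2)%:E).
  by apply/measurable_EFinP; exact: measurable_funX.
apply: (@le_trans _ _ (\int[mu]_(x in I01) ((P1 x ^+ 2)%:E + (P2 x ^+ 2)%:E))%E).
  apply: ae_ge0_le_integral => //.
  - by move=> x _; rewrite lee_fin /rp -!expr2 addr_ge0 ?sqr_ge0.
  - by have /integrableP[] := rip_int lg lg.
  - by move=> x _; rewrite adde_ge0 // lee_fin sqr_ge0.
  - by apply: emeasurable_funD; exact: measurable_funTS.
  by apply: ae01S gP => x _ ->; rewrite -EFinD.
rewrite ge0_integralD //=; try by [move=> x _;
  rewrite lee_fin sqr_ge0|exact: measurable_funTS|exact: measurable_I01].
have -> : d%:E = ((d / 2)%:E + (d / 2)%:E)%E by rewrite -EFinD -splitr.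
apply: leeD.
  apply: le_trans n1; apply: ge0_subset_integral => //; first exact: measurable_I01.
  by move=> x _; rewrite lee_fin sqr_ge0.
apply: le_trans n2; apply: ge0_subset_integral => //; first exact: measurable_I01.
by move=> x _; rewrite lee_fin sqr_ge0.
Unshelve. all: by end_near. Qed.

Lemma cvge0_near (f : R -> \bar R) :
  (forall d, 0 < d -> \forall s \near 0^'+, (0 <= f s <= d%:E)%E) ->
  f s @[s --> 0^'+] --> 0%E.
Proof.
move=> H; have ff : \forall s \near (0 : R)^'+, f s \is a fin_num.
  apply: filterS (H 1 ltr01) => s /andP[f0 f1].
  by rewrite ge0_fin_numE // (le_lt_trans f1) // ltry.
apply/fine_cvgP; split => //; apply/cvgrPdist_le => d d0.
apply: filterS2 ff (H d d0) => s fs /andP[f0 f1].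
by rewrite sub0r normrN /= ger0_norm ?fine_ge0 // -lee_fin fineK.
Qed.
End Comparison.

Theorem theorem5p2 (R : realType) (T : R) (a b q : R -> R)
    (u0 u1 : R -> R[i]) (u : R -> R -> R[i])
    (ae be qe : R -> R -> R) (u0e u1e : R -> R -> R[i])
    (ue : R -> R -> R -> R[i]) :
  0 < T ->
  Linf01 a -> Linf01 b -> Linf01 q ->
  ae01 (fun x => 0 <= a x) -> ae01 (fun x => 0 <= b x) ->
  L2_01 u0 -> (exists2 d2u0, L2_01 d2u0 & weak_derivative2 u0 d2u0) ->
  L2_01 u1 ->
  classical_solution T a b q u0 u1 u ->
  regularising_coef a ae -> regularising_coef b be -> regularising_coef q qe ->
  Linf_norm (fun x => ae eps x - a x) @[eps --> 0^'+] --> 0%E ->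
  Linf_norm (fun x => be eps x - b x) @[eps --> 0^'+] --> 0%E ->
  Linf_norm (fun x => qe eps x - q x) @[eps --> 0^'+] --> 0%E ->
  regularising_data u0 u0e -> regularising_data u1 u1e ->
  very_weak_solution T ae be qe u0e u1e ue ->
  ereal_sup [set L2_norm (fun x => ue eps t x - u t x) | t in `[0, T]]
    @[eps --> 0^'+] --> 0%E.
Proof.
move=> T0 la lb lq _ _ _ _ _ [lam [phi [ut [ru [eb S]]]]] ra rb rq ca cb cq d0 d1.
move=> [_ _ _ _ [lame [phie [ute [rue [ebe Se _]]]]]].
have [Ka ba] := Linf_bounded_coef la; have [Kb bb] := Linf_bounded_coef lb.
have [Kq bq] := Linf_bounded_coef lq.
have cu := wave_cont_L2 S; have cut := wave_cont_deriv S.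
have [Cu Cu0 uC] := nrm_bounded (ltW T0) cu.
have [Cv Cv0 vC] := nrm_bounded (ltW T0) cut.
have TT : 0 <= (0 : R) <= T by rewrite lexx ltW.
apply: cvge0_near => eta eta0.
(* The estimate of wave_comparison with rho = de <= 1 is at most X * de. *)
pose X := (2 * (3 + 2 * (Kb + 1) ^+ 2) + 2 * (4 * (4 * Cu ^+ 2) + 4 * Cv ^+ 2))
  * growth Ka Kb Kq T.
have X0 : 0 <= X.
  apply: mulr_ge0; last exact: expR_ge0.
  apply: addr_ge0; apply: mulr_ge0 => //; apply: addr_ge0 => //; apply: mulr_ge0 => //;
    by [exact: sqr_ge0|apply: mulr_ge0 => //; exact: sqr_ge0].
pose de := Num.min 1 (eta ^+ 2 / (X + 1)).
have X10 : 0 < X + 1 by rewrite ltr_wpDl.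
have de0 : 0 < de by rewrite lt_min ltr01 divr_gt0 // exprn_gt0.
have de1 : de <= 1 by rewrite ge_min lexx.
have deX : X * de <= eta ^+ 2.
  apply: (@le_trans _ _ ((X + 1) * de)); first by apply: ler_wpM2r; rewrite ?(ltW de0) // lerDl.
  by rewrite mulrC -ler_pdivlMr // ge_min lexx orbT.
have s1 : \forall s \near (0 : R)^'+, 0 < s <= 1.
  near=> s; apply/andP; split; near: s; [exact: nbhs_right_gt|exact: nbhs_right_le].
have sa := near_Linf de0 ca; have sb := near_Linf de0 cb; have sq := near_Linf de0 cq.
have s_0 := regularising_data_small d0 de0; have s_1 := regularising_data_small d1 de0.
near=> s.
have s01 : 0 < s <= 1 by near: s.
have {}Se := Se s s01; have {}ebe := ebe s s01.
have cu' := wave_cont_L2 Se; have cut' := wave_cont_deriv Se.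
have da : bounded_coef de (fun x => ae s x - a x).
  split; [exact: ltW| |by apply: Linf_le; near: s].
  apply: measurable_funB; first exact: regularising_measurable ra s01.
  by case: ba.
have db : bounded_coef de (fun x => be s x - b x).
  split; [exact: ltW| |by apply: Linf_le; near: s].
  apply: measurable_funB; first exact: regularising_measurable rb s01.
  by case: bb.
have dq : bounded_coef de (fun x => qe s x - q x).
  split; [exact: ltW| |by apply: Linf_le; near: s].
  apply: measurable_funB; first exact: regularising_measurable rq s01.
  by case: bq.
have [lu0 _] := cu 0 TT; have [lv0 _] := cut 0 TT.
have [lu0' _] := cu' 0 TT; have [lv0' _] := cut' 0 TT.
have w0 : nrm2 (fun x => ue s 0 x - u 0 x) <= de.
  have h : forall g, L2_01 g -> ae01 (fun x => g x = u0e s x - u0 x) -> nrm2 g <= de by near: s.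
  apply: h; first exact: L2_B.
  by apply: ae01S (ae01I (wave_init0 Se) (wave_init0 S)) => x _ [-> ->].
have w1 : nrm2 (fun x => ute s 0 x - ut 0 x) <= de.
  have h : forall g, L2_01 g -> ae01 (fun x => g x = u1e s x - u1 x) -> nrm2 g <= de by near: s.
  apply: h; first exact: L2_B.
  by apply: ae01S (ae01I (wave_init1 Se) (wave_init1 S)) => x _ [-> ->].
have main t : 0 <= t <= T -> nrm2 (fun x => ue s t x - u t x) <= eta ^+ 2.
  move=> tT.
  have := wave_comparison T0 eb ebe cu cut (wave_deriv S) (wave_eq S) cu' cut'
    (wave_deriv Se) (wave_eq Se) ba bb bq da db dq de1 uC vC w0 w1 tT.
  move=> /le_trans; apply; apply: le_trans deX.
  rewrite /X [leRHS]mulrAC; apply: ler_wpM2r; first exact: expR_ge0.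
  have -> : 2 * ((3 + 2 * (Kb + 1) ^+ 2) * de)
      + 2 * (4 * ((2 * de) ^+ 2 * Cu ^+ 2) + 4 * (de ^+ 2 * Cv ^+ 2))
    = 2 * (3 + 2 * (Kb + 1) ^+ 2) * de
      + 2 * (4 * (4 * Cu ^+ 2) + 4 * Cv ^+ 2) * de ^+ 2 by ring.
  rewrite [leRHS]mulrDl lerD2l; apply: ler_wpM2l.
    apply: mulr_ge0 => //; apply: addr_ge0; apply: mulr_ge0 => //; last exact: sqr_ge0.
    by apply: mulr_ge0 => //; exact: sqr_ge0.
  by rewrite expr2 ler_piMl // ltW.
apply/andP; split.
  apply: (@le_trans _ _ (L2_norm (fun x => ue s 0 x - u 0 x))).
    exact: Lnorm_ge0.
  by apply: ereal_sup_ubound; exists 0; rewrite //= in_itv.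
apply: ge_ereal_sup => _ [t tT <-].
have tT' : 0 <= t <= T by move: tT; rewrite /= in_itv.
have [lt _] := cu t tT'; have [lt' _] := cu' t tT'.
rewrite L2_normE; last exact: L2_B.
by rewrite lee_fin -/(nrm _) le_nrm ?(ltW eta0) //; exact: main.
Unshelve. all: by end_near. Qed.
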